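(* Let $\mathcal{M}=(G,In,Out,L)$ be a linear compartmental model with $L=In\cup Out$, and assume that either $G$ is strongly input-output connected and $|Out|=1$, or $G$ is strongly connected and $|In|=1$. Let $\widetilde{\mathcal{M}}=(G,In,Out,V)$ be the corresponding model with a leak in every compartment. Then $\mathcal{M}$ is locally identifiable if and only if $\widetilde{\mathcal{M}}$ is an identifiable path/cycle model.
   Context: A linear compartmental model $(G,In,Out,Leak)$ consists of a finite directed graph $G=(V,E)$ (no self-loops, no repeated edges) and subsets $In,Out,Leak\subseteq V$ (input, output and leak compartments; $In,Out$ nonempty). Each edge $j\to i$ carries an independent parameter $a_{ij}$ and each $i\in Leak$ an independent parameter $a_{0i}$. The compartmental matrix $A$ has $A_{ij}=a_{ij}$ if $j\to i\in E$; $A_{ii}=-a_{0i}-\sum_{k:\,i\to k\in E}a_{ki}$ if $i\in Leak$; $A_{ii}=-\sum_{k:\,i\to k\in E}a_{ki}$ if $i\notin Leak$; all other entries $0$. The model is the system $x'=Ax+u$, $y_i=x_i$ for $i\in Out$, with $u_i\equiv 0$ for $i\notin In$. When $Leak=V$, the diagonal entries $a_{ii}:=A_{ii}$ are algebraically independent and are used as parameters in place of the $a_{0i}$. When every vertex has a directed path to every output (which holds under the hypotheses here), the input-output equation for $j\in Out$ is $\det(\partial I-A)\,y_j=\sum_{i\in In}(-1)^{i+j}\det(\partial I-A)_{ij}\,u_i$, where $\partial=d/dt$ and $(\cdot)_{ij}$ means delete row $i$ and column $j$. The coefficient map $c:\mathbb{R}^{|E|+|Leak|}\to\mathbb{R}^k$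 collects all nonzero, nonmonic coefficients (polynomials in the parameters) of these equations over all $j\in Out$. A cycle is a closed directed path with no repeated vertices; to a cycle or directed path associate the monomial that is the product of the parameters of its edges. The diagonal entries $a_{ii}$ count as monomial cycles of length 1 (self-cycles). $G$ is strongly input-output connected if it is connected (as an undirected graph) and every edge lies in a cycle or in a directed path from an input vertex to an output vertex. A function $f$ of the parameters is locally identifiable (from $c$) if there is a finitely multivalued function $\Phi$ with $\Phi\circ c=f$ (generically). A model $(G,In,Out,V)$ is an identifiable path/cycle model if all of the independent monomial cycles (including self-cycles) and monomial paths from input to output are locally identifiable and each parameter is contained in such a cycle or path. A model is (generically) locally identifiable if, outside a set of measure zero in parameter space, every point has a neighborhood on which $c$ is one-to-one; equivalently, the Jacobian of $c$ has rank $|E|+|Leak|$ at a generic point. *)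

(* Defs.v *)
From mathcomp Require Import all_boot all_order all_algebra.
From mathcomp Require Import all_classical all_reals all_analysis.

Set Implicit Arguments.
Unset Strict Implicit.
Unset Printing Implicit Defensive.

Import Order.TTheory GRing.Theory Num.Theory.
Import numFieldNormedType.Exports.

Local Open Scope classical_set_scope.
Local Open Scope ring_scope.

(** * Linear compartmental models *)

(* [graph j i] is the edge j -> i, whose parameter is written a_ij. *)
Record lcmodel (n : nat) := LCModel {
  graph : rel 'I_n;
  inputs : {set 'I_n};
  outputs : {set 'I_n};
  leaks : {set 'I_n};
  graph_irreflexive : irreflexive graph;
  inputs_neq0 : inputs != finset.set0;
  outputs_neq0 : outputs != finset.set0 }.

Definition full_leak n (M : lcmodel n) : lcmodel n :=
  LCModel [set: 'I_n]%SET
    (graph_irreflexive M) (inputs_neq0 M) (outputs_neq0 M).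

(** ** Parameters *)

Notation edge_type M := {e : 'I_ _ * 'I_ _ | graph M e.1 e.2}.
Notation leak_type M := {i : 'I_ _ | i \in leaks M}.

(* [inr i] is a_0i, except if every compartment leaks: then it is the diagonal
   entry a_ii, see [comp_mx]. *)
Notation param M := (edge_type M + leak_type M)%type.

(** ** Cycles and paths *)

Section Graph.
Variables (n : nat) (M : lcmodel n).

Definition is_cycle (s : seq 'I_n) : Prop := s <> [::] /\ ucycle (graph M) s.

Definition cycle_edges (s : seq 'I_n) : seq ('I_n * 'I_n) := zip s (rot 1 s).

(* A path is given by its first vertex [x] and the list [s] of the next ones;
   if [x] is both an input and an output, [s] may be empty. *)
Definition is_io_path (x : 'I_n) (s : seq 'I_n) : Prop :=
  [/\ x \in inputs M, last x s \in outputs M, path (graph M) x s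
    & uniq (x :: s)].

Definition path_edges (x : 'I_n) (s : seq 'I_n) : seq ('I_n * 'I_n) :=
  zip (x :: s) s.

Definition strongly_connected : Prop := forall x y, connect (graph M) x y.

Definition weakly_connected : Prop :=
  forall x y, connect [rel u v | graph M u v || graph M v u] x y.

Definition strongly_io_connected : Prop :=
  weakly_connected /\
  forall x y, graph M x y ->
    (exists2 s, is_cycle s & (x, y) \in cycle_edges s) \/
    (exists z s, is_io_path z s /\ (x, y) \in path_edges z s).

(* Monomials are lists of parameters. *)
Definition edge_monomial (es : seq ('I_n * 'I_n)) : seq (param M) :=
  [seq inl e | e <- pmap insub es].

(* The self-cycles [:: inr i] are meant for models with a leak in every
   compartment. *)
Definition path_cycle_monomial (m : seq (param M)) : Prop :=
  [\/ exists2 s, is_cycle s & m = edge_monomial (cycle_edges s),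
      exists i : leak_type M, m = [:: inr i]
    | exists x s, is_io_path x s /\ m = edge_monomial (path_edges x s)].

End Graph.

(** * Negligible subsets of R^N *)

(* Lebesgue-null sets: for every e > 0 there is a countable cover by closed
   boxes of total volume at most e. (For N > 0, as is the case here.) *)
Definition lebesgue_null (R : realType) (N : nat) (Z : set 'rV[R]_N) : Prop :=
  forall e : R, 0 < e -> exists lo hi : nat -> 'rV[R]_N,
    [/\ forall k i, lo k 0 i <= hi k 0 i,
        Z `<=` \bigcup_k [set x | forall i, lo k 0 i <= x 0 i <= hi k 0 i]
      & (\sum_(0 <= k <oo) (\prod_i (hi k 0 i - lo k 0 i))%:E <= e%:E)%E].

(** * The coefficient map *)

Section Coefficients.
Variables (R : realType) (n : nat) (M : lcmodel n).

Local Notation pspace := 'rV[R]_#|{: param M}|.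

Implicit Type p : pspace.

Definition pval p (t : param M) : R := p 0 (enum_rank t).

Definition edge_val p (i j : 'I_n) : R :=
  if insub (j, i) is Some e then pval p (inl e) else 0.

Definition leak_val p (i : 'I_n) : R :=
  if insub i is Some l then pval p (inr l) else 0.

Definition comp_mx p : 'M[R]_n :=
  \matrix_(i, j)
    if i == j then
      if leaks M == [set: 'I_n]%SET then leak_val p i
      else - leak_val p i - \sum_(k | graph M i k) edge_val p k i
    else edge_val p i j.

Definition monomial_val (m : seq (param M)) p : R := \prod_(t <- m) pval p t.

(* [inl (j, d)] is the coefficient of the d-th derivative of y_j, and
   [inr (i, j, d)] that of the d-th derivative of u_i, in the input-output
   equation of the output j. *)
Local Notation coef_index := ('I_n * 'I_n.+1 + 'I_n * 'I_n * 'I_n.+1)%type.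

Definition coef (k : coef_index) p : R :=
  match k with
  | inl (j, d) => (char_poly (comp_mx p))`_d
  | inr (i, j, d) => (cofactor (char_poly_mx (comp_mx p)) i j)`_d
  end.

Definition coef_present (k : coef_index) : bool :=
  match k with
  | inl (j, d) => j \in outputs M
  | inr (i, j, d) => (i \in inputs M) && (j \in outputs M)
  end.

Definition coef_kept (k : coef_index) : bool :=
  coef_present k && `[< coef k <> cst 0 /\ coef k <> cst 1 >].

Local Notation cspace := {ffun {k : coef_index | coef_kept k} -> R}.

Definition io_coef_map p : cspace := [ffun k => coef (val k) p].

(** * Identifiability *)

Definition locally_identifiable : Prop :=
  exists2 Z : set pspace, lebesgue_null Z &
    forall p, ~ Z p -> exists2 U : set pspace, nbhs p U & set_inj U io_coef_map.

(* [Phi] is the finitely multivalued function. *)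
Definition locally_identifiable_fun (f : pspace -> R) : Prop :=
  exists Phi : cspace -> set R, (forall c, finite_set (Phi c)) /\
    exists2 Z : set pspace, lebesgue_null Z &
      forall p, ~ Z p -> Phi (io_coef_map p) (f p).

(* Every non-constant monomial belongs to some maximal independent family of
   monomial cycles and paths, so "all of the independent monomial cycles and
   paths" are all of them; the constant monomial 1 of an empty path is
   identifiable anyway. *)
Definition identifiable_path_cycle_model : Prop :=
  [/\ leaks M = [set: 'I_n]%SET,
      forall m, path_cycle_monomial m ->
        locally_identifiable_fun (monomial_val m)
    & forall t : param M, exists2 m, path_cycle_monomial m & t \in m].

End Coefficients.

(* Main.v *)
Require Import Defs.
From HB Require Import structures.
From mathcomp Require Import all_boot all_order all_algebra.
From mathcomp Require Import all_classical all_reals all_analysis.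
From mathcomp Require Import measurable_realfun ring lra zify.
From mathcomp Require Import -(notations) mpoly.

Set Implicit Arguments.
Unset Strict Implicit.
Unset Printing Implicit Defensive.

Import Order.TTheory GRing.Theory Num.Theory.
Import numFieldNormedType.Exports.

Local Open Scope classical_set_scope.
Local Open Scope ring_scope.

(** Write c for the coefficient map of a model, A(p) for the compartmental
    matrix at the parameters p, L for the set of inputs and outputs, and call
    full-leak model the model with a leak in every compartment.  Both sides of
    the equivalence amount to the Jacobian of c for M having independent rows
    (that is, rank the number of parameters) at some point.

    A torus relates the two models.  A diagonal matrix D that is 1 on L acts on
    the parameters of the full-leak model by A |-> D A D^-1, and neither the
    coefficients [coef_row_act] nor the monomial cycles and paths
    [monomial_val_act] change.  M sits in the full-leak model as the matrices
    whose columns outside L have sum zero, and a generic matrix can be brought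
    to this form by the torus [torus_normal_form]: the condition is
    sum_k d_k A_ki = 0 for i outside L, which is linear in d, and it determines
    d because every compartment reaches an output.

    Suppose first that M is locally identifiable.  A polynomial that takes
    finitely many values near a generic point of a generic fibre of c is
    constant to first order along the fibre [finite_fibre_gradient]; applied to
    the coordinates, this says that the Jacobian of c has full rank.  Then as
    many coefficients as there are parameters are independent, so each monomial
    cycle or path satisfies on M a nontrivial polynomial equation over the
    coefficients [algebraic_relation].  The torus carries the equation over to
    the full-leak model, and its roots are the finitely many values required
    [monomial_identifiable].

    Conversely, let every monomial cycle and path of the full-leak model be
    identifiable.  By [finite_fibre_gradient], at a generic point each of them
    is constant to first order along the fibre of c; by the torus the point may
    be taken in M.  Let v be a tangent vector of M killed by the Jacobian of c
    at this point.  The logarithmic derivatives of the edge parameters along v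
    then add up to 0 along all cycles and all paths from inputs to outputs, so
    they are the differences of a potential that vanishes on L
    [exists_potential]; as the columns outside L have sum zero, the potential
    is in the kernel of the linear system above, hence zero, and so is v
    [tangent_trivial].  Full rank at one point is full rank outside the zero
    set of a polynomial, where c is locally injective
    [full_rank_locally_injective].

    The measure theory behind this is elementary: countable unions and
    Lipschitz images of null sets are null [lebesgue_null_lipschitz], a ball is
    not null [not_lebesgue_null_ball], and the zeros of a nonzero polynomial
    are null [lebesgue_null_zeros]. *)

(** * Matrices and their norm *)

Lemma row_free_inj (F : fieldType) m n (A : 'M[F]_(m, n)) :
  (forall v : 'rV_m, v *m A = 0 -> v = 0) -> row_free A.
Proof.
move=> inj; rewrite -kermx_eq0; apply/eqP/row_matrixP => i; rewrite row0.
by apply: inj; rewrite -row_mul mulmx_ker row0.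
Qed.

Section MatrixNorm.
Variable R : realType.

Lemma norm_entry m n (A : 'M[R]_(m, n)) i j : `|A i j| <= `|A|.
Proof.
rewrite [leRHS]/Num.norm /= mx_normrE.
by apply/bigmax_geP; right; exists (i, j).
Qed.

Lemma norm_mx_le m n (A : 'M[R]_(m, n)) (c : R) :
  0 <= c -> (forall i j, `|A i j| <= c) -> `|A| <= c.
Proof.
move=> c0 Ac; rewrite [leLHS]/Num.norm /= mx_normrE.
by apply/bigmax_leP; split=> // -[i j] _ /=.
Qed.

Lemma norm_mulmx m n p (A : 'M[R]_(m, n)) (B : 'M[R]_(n, p)) :
  `|A *m B| <= n%:R * `|A| * `|B|.
Proof.
apply: norm_mx_le => [|i j]; first by rewrite !mulr_ge0.
rewrite mxE; apply: le_trans (ler_norm_sum _ _ _) _.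
rewrite -mulrA mulr_natl -[X in _ *+ X]card_ord -sumr_const.
by apply: ler_sum => k _; rewrite normrM ler_pM // norm_entry.
Qed.

End MatrixNorm.

(** * Null sets of R^N *)

Section NullSets.
Variables (R : realType) (N : nat).
Hypothesis N_gt0 : (0 < N)%N.

Local Notation box := ('rV[R]_N * 'rV[R]_N)%type.

Definition in_box (b : box) : set 'rV[R]_N :=
  [set x | forall i, b.1 0 i <= x 0 i <= b.2 0 i].

Definition volume (b : box) : R := \prod_i (b.2 0 i - b.1 0 i).

Definition proper_box (b : box) : Prop := forall i, b.1 0 i <= b.2 0 i.

(** Outer Lebesgue measure at most e, with the infimum over covers attained; e is
    an extended real so that countable unions need no summability. *)
Definition coverable (A : set 'rV[R]_N) (e : \bar R) : Prop :=
  exists b : nat -> box,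
    [/\ forall k, proper_box (b k), A `<=` \bigcup_k in_box (b k)
      & (\sum_(0 <= k <oo) (volume (b k))%:E <= e)%E].

Lemma lebesgue_nullP (A : set 'rV[R]_N) :
  lebesgue_null A <-> forall e : R, 0 < e -> coverable A e%:E.
Proof.
split=> nullA e e_gt0; have := nullA e e_gt0.
  by case=> lo [hi [lohi Acov sumle]]; exists (fun k => (lo k, hi k)).
case=> b [bP Acov sumle].
by exists (fun k => (b k).1), (fun k => (b k).2).
Qed.

Lemma volume_ge0 b : proper_box b -> 0 <= volume b.
Proof. by move=> bP; apply: prodr_ge0 => i _; rewrite subr_ge0. Qed.

Lemma coverableW (A B : set 'rV[R]_N) (e f : \bar R) :
  A `<=` B -> (e <= f)%E -> coverable B e -> coverable A f.
Proof.
move=> AB ef [b [bP Bcov sumle]]; exists b; split=> //.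
  exact: subset_trans Bcov.
exact: le_trans ef.
Qed.

Lemma coverable_box b : proper_box b -> coverable (in_box b) (volume b)%:E.
Proof.
move=> bP; exists (fun k => if k == 0%N then b else (0, 0)); split.
- by move=> k /=; case: (k == 0%N) => // i /=.
- by move=> x bx; exists 0%N.
rewrite (nneseries_split 0 1); last by case=> *; rewrite lee_fin volume_ge0.
rewrite big_nat1 /= eseries0 ?adde0 // => -[//|k] _ _.
rewrite /volume (eq_bigr (fun=> 0)) ?prodr_const ?card_ord ?expr0n.
  by rewrite gtn_eqF.
by move=> i _; rewrite !mxE subrr.
Qed.

Lemma coverable0 : coverable set0 0%E.
Proof.
have b0 : proper_box (0, 0) by move=> i /=.
suff -> : 0%E = (volume (0, 0))%:E.
  exact: coverableW (sub0set _) (lexx _) (coverable_box b0).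
rewrite /volume (eq_bigr (fun=> 0)) ?prodr_const ?card_ord ?expr0n.
  by rewrite gtn_eqF.
by move=> i _; rewrite !mxE subrr.
Qed.

Lemma coverable_ge0 (A : set 'rV[R]_N) e : coverable A e -> (0 <= e)%E.
Proof.
case=> b [bP _]; apply: le_trans; apply: nneseries_ge0 => k _ _.
by rewrite lee_fin volume_ge0.
Qed.

(** The covers of the A k, indexed by pairs, are enumerated through a bijection
    between the pairs of natural numbers and the natural numbers. *)
Lemma coverable_bigcup (A : nat -> set 'rV[R]_N) (e : nat -> \bar R) :
  (forall k, coverable (A k) (e k)) ->
  coverable (\bigcup_k A k) (\sum_(0 <= k <oo) e k)%E.
Proof.
move=> Acov.
have [b bP] : {b : nat -> nat -> box & forall n,
    [/\ forall k, proper_box (b n k), A n `<=` \bigcup_k in_box (b n k)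
      & (\sum_(0 <= k <oo) (volume (b n k))%:E <= e n)%E]}.
  by apply: (@choice _ _ (fun n (b : nat -> box) =>
    [/\ forall k, proper_box (b k), A n `<=` \bigcup_k in_box (b k)
      & (\sum_(0 <= k <oo) (volume (b k))%:E <= e n)%E])).
have v0 n k : (0 <= (volume (b n k))%:E)%E.
  by rewrite lee_fin volume_ge0 //; case: (bP n).
have /card_esym/ppcard_eqP[f] := card_nat2.
exists (fun j => b (f j).1 (f j).2); split.
- by move=> j; have [] := bP (f j).1.
- move=> x [n _ Anx]; have [_ /(_ x Anx)[k _ bx] _] := bP n.
  by exists (f^-1%FUN (n, k)) => //=; rewrite invK ?inE.
apply: (@le_trans _ _ (\sum_(0 <= n <oo) \sum_(0 <= k <oo) (volume (b n k))%:E)%E);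
  last first.
  apply: lee_nneseries => n.
    by move=> _ _; apply: nneseries_ge0 => *; apply: v0.
  by move=> _; have [] := bP n.
rewrite (nneseries_esumT (fun n => nneseries_ge0 (fun k _ _ => v0 n k))).
have -> : (\esum_(n in [set: nat]) \sum_(0 <= k <oo) (volume (b n k))%:E =
    \esum_(n in [set: nat]) \esum_(k in [set: nat]) (volume (b n k))%:E)%E.
  by apply: eq_esum => n _; rewrite nneseries_esumT // => k; apply: v0.
rewrite esum_esum; last by move=> *; apply: v0.
rewrite nneseries_esumT; last by move=> j; apply: v0.
rewrite le_eqVlt; apply/orP; left; apply/eqP/esym.
have := @reindex_esum R nat (nat * nat)%type setT setT f
  (fun k => (volume (b k.1 k.2))%:E) (@bij _ _ _ _ _).
by move=> <-; congr esum; rewrite predeqE => -[].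
Qed.

Lemma coverableU (A B : set 'rV[R]_N) e f :
  coverable A e -> coverable B f -> coverable (A `|` B) (e + f)%E.
Proof.
move=> Ae Bf.
have e0 := coverable_ge0 Ae; have f0 := coverable_ge0 Bf.
have := @coverable_bigcup (fun k => nth set0 [:: A; B] k)
  (fun k => nth 0%E [:: e; f] k) _.
have H : forall k, coverable (nth set0 [:: A; B] k) (nth 0%E [:: e; f] k).
  by move=> [|[|k]] //=; rewrite !nth_nil; exact: coverable0.
move=> /(_ H); apply: coverableW.
  by move=> x [Ax|Bx]; [exists 0%N | exists 1%N].
rewrite (nneseries_split 0 2).
  rewrite !big_nat_recr //= big_geq // add0e.
  rewrite eseries0 ?adde0 // => k + _.
  by case: k => [|[|k]] //= _; rewrite nth_nil.
by move=> [|[|k]] //= _ ; rewrite nth_nil.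
Qed.

Lemma coverable_bigcup_fin (I : finType) (P : pred I) (A : I -> set 'rV[R]_N)
    (e : R) : 0 <= e ->
  (forall i, P i -> coverable (A i) e%:E) ->
  coverable (\bigcup_(i in [set i | P i]) A i) (#|P|%:R * e)%:E.
Proof.
move=> e0 Acov.
have main (s : seq I) : all P s ->
    coverable (\bigcup_(i in [set i | i \in s]) A i) ((size s)%:R * e)%:E.
  elim: s => [_|i s IHs /= /andP[Pi Ps]].
    by rewrite mul0r; apply: coverableW coverable0 => // x [].
  have := coverableU (Acov i Pi) (IHs Ps).
  rewrite -EFinD -[X in X + _]mul1r -mulrDl -mulrS.
  apply: coverableW => // x [j /=].
  by rewrite inE => /predU1P[->|js] Ajx; [left | right; exists j].
rewrite cardE.
have /main : all P (enum P) by apply/allP => i; rewrite mem_enum.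
by apply: coverableW => // x [i Pi Ax]; exists i => //=; rewrite mem_enum.
Qed.

Lemma lebesgue_null_sub (A B : set 'rV[R]_N) :
  A `<=` B -> lebesgue_null B -> lebesgue_null A.
Proof.
move=> AB /lebesgue_nullP nullB; apply/lebesgue_nullP => e e0.
exact: coverableW AB (lexx _) (nullB e e0).
Qed.

Lemma lebesgue_null_bigcup (A : nat -> set 'rV[R]_N) :
  (forall k, lebesgue_null (A k)) -> lebesgue_null (\bigcup_k A k).
Proof.
move=> nullA; apply/lebesgue_nullP => e e0.
apply: coverableW (@subset_refl _ _) (epsilon_trick0 xpredT (ltW e0)) _.
apply: (@coverable_bigcup A (fun k => (e / (2 ^ k.+1)%:R)%:E)) => k.
move/lebesgue_nullP: (nullA k); apply.
by rewrite divr_gt0 // ltr0n expn_gt0.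
Qed.

Lemma lebesgue_null_countable (I : countType) (A : I -> set 'rV[R]_N) :
  (forall i, lebesgue_null (A i)) -> lebesgue_null (\bigcup_i A i).
Proof.
move=> nullA.
apply: (@lebesgue_null_sub _
  (\bigcup_k (if unpickle k is Some i then A i else set0))).
  by move=> x [i _ Aix]; exists (pickle i) => //; rewrite pickleK.
apply: lebesgue_null_bigcup => k; case: (unpickle k) => [i|]; first exact: nullA.
by apply/lebesgue_nullP => e e0; apply: coverableW coverable0 => //; rewrite lee_fin ltW.
Qed.

Lemma lebesgue_nullU (A B : set 'rV[R]_N) :
  lebesgue_null A -> lebesgue_null B -> lebesgue_null (A `|` B).
Proof.
move=> nA nB; apply: (@lebesgue_null_sub _ (\bigcup_(b : bool) (if b then A else B))).
  by move=> x [Ax|Bx]; [exists true | exists false].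
by apply: lebesgue_null_countable => -[].
Qed.

Lemma lebesgue_null_set0 : lebesgue_null (@set0 'rV[R]_N).
Proof.
by apply/lebesgue_nullP => e e0; apply: coverableW coverable0 => //; rewrite lee_fin ltW.
Qed.

End NullSets.

(** The weighted number of intervals that contain t has integral at most the
    weighted total length over [a, a + d]; it cannot exceed its mean value
    everywhere. *)
Lemma interval_average (R : realType) (w l h : nat -> R) (a d c : R) :
  (forall k, 0 <= w k) -> (forall k, l k <= h k) -> 0 < d -> 0 <= c ->
  (forall t, a <= t <= a + d ->
    (c%:E <= \sum_(0 <= k <oo) (w k * (l k <= t <= h k)%R%:R)%:E)%E) ->
  ((c * d)%:E <= \sum_(0 <= k <oo) (w k * (h k - l k))%:E)%E.
Proof.
move=> w0 lh d0 c0 cle.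
pose mu := @lebesgue_measure R.
have muI (x y : R) : x <= y -> (mu `[x, y]%classic = (y - x)%:E)%E.
  move=> xy; rewrite /mu lebesgue_measure_itv /= lte_fin.
  by case: ltgtP xy => // -> _; rewrite subrr.
pose D := `[a, a + d]%classic : set (measurableTypeR R).
have mD : measurable D by exact: measurable_itv.
pose f k (t : measurableTypeR R) : \bar R :=
  ((w k)%:E * (\1_(`[l k, h k]%classic) t)%:E)%E.
have mf k : measurable_fun D (f k).
  apply: (measurable_funS measurableT) => //.
  apply: emeasurable_funM => //; apply/measurable_EFinP.
  exact: measurable_indic.
have f0 k t : D t -> (0 <= f k t)%E.
  by move=> _; rewrite mule_ge0 // lee_fin.
have fE k t : f k t = (w k * (l k <= t <= h k)%R%:R)%:E.
  rewrite /f -EFinM indicE; congr (_ * _%:R)%:E; congr nat_of_bool.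
  by apply/idP/idP; rewrite inE /= in_itv.
have -> : (c * d)%:E = (\int[mu]_(t in D) c%:E)%E.
  rewrite integral_cst // EFinM; congr (_ * _)%E; apply/esym.
  by apply: etrans (muI a (a + d) _) _; rewrite ?lerDl ?ltW // addrC addKr.
apply: (@le_trans _ _ (\int[mu]_(t in D) \sum_(0 <= k <oo) f k t)%E).
  apply: ge0_le_integral => //.
  - by apply: (@ge0_emeasurable_sum _ _ R D f xpredT) => [k t Dt _|//]; exact: f0.
  - move=> t; rewrite /D /= in_itv /= => /cle /le_trans; apply.
    by under [leRHS]eq_eseriesr do rewrite fE.
rewrite integral_nneseries //; apply: lee_nneseries.
  by move=> k _ _; apply: integral_ge0 => t; exact: f0.
move=> k _; rewrite /f ge0_integralZl //; last 2 first.
- by apply/measurable_EFinP/measurable_funTS; exact: measurable_indic.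
- by rewrite lee_fin.
rewrite integral_indic // EFinM lee_wpmul2l ?lee_fin //.
by rewrite -muI //; apply: le_measure; rewrite ?inE //; exact: measurableI.
Qed.

Section Cube.
Variables (R : realType) (N : nat).

(** A point outside the boxes is found one coordinate at a time.  Once j
    coordinates of x are chosen, the sum over the boxes that x still meets of the
    volumes of their sections in the remaining coordinates is kept below the
    volume d ^ (N - j) of the remaining cube.  At the end this sum counts the
    boxes that contain x, and it is less than 1. *)
Lemma cube_not_covered (b : nat -> 'rV[R]_N * 'rV[R]_N) (a : 'rV[R]_N) (d : R) :
  0 < d -> (forall k, proper_box (b k)) ->
  (\sum_(0 <= k <oo) (volume (b k))%:E < (d ^+ N)%:E)%E ->
  exists2 x : 'rV[R]_N, forall i, a 0 i <= x 0 i <= a 0 i + d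
    & forall k, ~ in_box (b k) x.
Proof.
move=> d0 bP sumlt.
pose hit k (x : 'rV[R]_N) (i : 'I_N) := ((b k).1 0 i <= x 0 i <= (b k).2 0 i)%R.
pose len k (i : 'I_N) := (b k).2 0 i - (b k).1 0 i.
have len0 k i : 0 <= len k i by rewrite subr_ge0; exact: bP.
pose F j x k (i : 'I_N) : R := if (i < j)%N then (hit k x i)%:R else len k i.
have F0 j x k i : 0 <= F j x k i by rewrite /F; case: ifP.
have main j : (j <= N)%N -> exists2 x : 'rV[R]_N,
    forall i, a 0 i <= x 0 i <= a 0 i + d &
    (\sum_(0 <= k <oo) (\prod_i F j x k i)%:E < (d ^+ (N - j))%:E)%E.
  elim: j => [_|j IHj ltjN].
    exists a => [i|]; first by rewrite lexx lerDl ltW.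
    rewrite subn0; apply: le_lt_trans sumlt.
    by under eq_eseriesr do under eq_bigr do rewrite /F ltn0.
  have [x xa sumx] := IHj (ltnW ltjN).
  pose i0 := Ordinal ltjN.
  pose upd t : 'rV[R]_N := \row_i if i == i0 then t else x 0 i.
  pose w k := \prod_(i | i != i0) F j x k i.
  have w0 k : 0 <= w k by apply: prodr_ge0.
  have sumupd t : (\sum_(0 <= k <oo) (\prod_i F j.+1 (upd t) k i)%:E =
      \sum_(0 <= k <oo) (w k * ((b k).1 0 i0 <= t <= (b k).2 0 i0)%R%:R)%:E)%E.
    apply: eq_eseriesr => k _; rewrite (bigD1 i0) //= mulrC; congr (_ * _)%:E.
      apply: eq_bigr => i ii0; rewrite /F ltnS leq_eqVlt.
      have /negbTE -> : nat_of_ord i != j by [].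
      by rewrite /= /hit mxE (negbTE ii0).
    by rewrite /F /= ltnSn /hit mxE eqxx.
  have sumj : (\sum_(0 <= k <oo) (\prod_i F j x k i)%:E =
      \sum_(0 <= k <oo) (w k * ((b k).2 0 i0 - (b k).1 0 i0))%:E)%E.
    apply: eq_eseriesr => k _; rewrite (bigD1 i0) //= mulrC; congr (_ * _)%:E.
    by rewrite /F /= ltnn.
  have [[t ta tlt]|no] := pselect (exists2 t, a 0 i0 <= t <= a 0 i0 + d &
      (\sum_(0 <= k <oo) (\prod_i F j.+1 (upd t) k i)%:E <
        (d ^+ (N - j.+1))%:E)%E).
    exists (upd t) => // i; rewrite mxE; case: eqP => [->//|_]; exact: xa.
  exfalso; move: sumx; apply/negP; rewrite -leNgt sumj.
  have -> : d ^+ (N - j) = d ^+ (N - j.+1) * d.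
    by rewrite -exprSr subnS prednK ?subn_gt0.
  apply: (@interval_average _ w (fun k => (b k).1 0 i0) _ (a 0 i0)) => //.
  - by move=> k; exact: bP.
  - by rewrite exprn_ge0 // ltW.
  - move=> t ta; rewrite -sumupd leNgt; apply/negP => tlt.
    by apply: no; exists t.
have [x xa sumx] := main N (leqnn N).
exists x => // k bkx; move: sumx; apply/negP; rewrite -leNgt subnn expr0.
rewrite (nneseries_split 0 k.+1); last first.
  by move=> *; rewrite lee_fin prodr_ge0.
rewrite add0n big_nat_recr //= (big1 _ _ (fun i => F N x k i)) //.
  rewrite addeAC leeDr // adde_ge0 ?sume_ge0 //.
    by move=> *; rewrite lee_fin prodr_ge0.
  by apply: nneseries_ge0 => *; rewrite lee_fin prodr_ge0.
by move=> i _; rewrite /F ltn_ord /hit bkx.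
Qed.

Lemma not_lebesgue_null_ball (Z : set 'rV[R]_N) (x : 'rV[R]_N) (r : R) :
  lebesgue_null Z -> 0 < r -> exists2 y, `|y - x| <= r & ~ Z y.
Proof.
move=> nullZ r0.
have [|b [bP Zb sumle]] := (lebesgue_nullP Z).1 nullZ (r ^+ N / 2).
  by rewrite divr_gt0 // exprn_gt0.
have [|y yx yb] := @cube_not_covered b x r r0 bP.
  apply: le_lt_trans sumle _; rewrite lte_fin ltr_pdivrMr // ltr_pMr ?exprn_gt0 //.
  by rewrite ltr1n.
exists y; last by move=> /Zb[k _]; exact: yb.
apply: norm_mx_le => [|i j]; first exact: ltW.
have := yx j; rewrite !mxE (ord1 i) => /andP[xy yxr].
by rewrite ger0_norm ?subr_ge0 // lerBlDl.
Qed.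

End Cube.

Section Lipschitz.
Variables (R : realType) (N : nat).
Local Notation "''V'" := ('rV[R]_N).

(** The volume of a box depends continuously on its sides. *)
Lemma prod_add_small (l : 'I_N -> R) (e : R) : 0 < e ->
  exists2 s, 0 < s & \prod_i (l i + s) <= \prod_i l i + e.
Proof.
move=> e0; pose p := \prod_i ((l i)%:P + 'X) : {poly R}.
have pE s : p.[s] = \prod_i (l i + s).
  by rewrite horner_prod; apply: eq_bigr => i _; rewrite !hornerE.
have : \forall s \near (0 : R), p.[s] < p.[0] + e.
  have := @continuous_horner R p 0.
  by move/cvgr_lt; apply; rewrite ltrDl.
move=> /nbhs_ballP[d /= d0 /(_ (d / 2)) lt_pe].
exists (d / 2); first by rewrite divr_gt0.
rewrite -!pE; apply: ltW; have -> : \prod_i l i = p.[0].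
  by rewrite pE; apply: eq_bigr => i _; rewrite addr0.
apply: lt_pe; rewrite /ball /= sub0r normrN ger0_norm ?divr_ge0 ?ltW //.
by rewrite ltr_pdivrMr // ltr_pMr // ltr1n.
Qed.

Hypothesis N_gt0 : (0 < N)%N.

Lemma coverable_ball (x : 'V) (r : R) : 0 <= r ->
  coverable [set y | `|y - x| <= r] ((2 * r) ^+ N)%:E.
Proof.
move=> r0; pose b := (\row_i (x 0 i - r), \row_i (x 0 i + r)).
have bP : proper_box b by move=> i; rewrite !mxE lerD // ge0_cp.
have <- : volume b = (2 * r) ^+ N.
  rewrite /volume (eq_bigr (fun=> 2 * r)) ?prodr_const ?card_ord // => i _.
  by rewrite !mxE; ring.
apply: coverableW (coverable_box N_gt0 bP) => // y /= yx i.
rewrite !mxE -ler_distl; apply: le_trans yx.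
by have := norm_entry (y - x) 0 i; rewrite !mxE.
Qed.

Variables (A : set 'V) (g : 'V -> 'V) (L : R).
Hypothesis L_gt0 : 0 < L.
Hypothesis g_lip : forall x y, A x -> A y -> `|g x - g y| <= L * `|x - y|.

(** The box is cut into cubes of side s, except that the last cube may stick out
    in each direction, which is why s has to be small compared with e.  The image
    of a cube of side s is in a ball of radius L s. *)
Lemma coverable_lipschitz_box (b : 'V * 'V) (e : R) :
  proper_box b -> 0 < e ->
  coverable (g @` (A `&` in_box b)) ((2 * L) ^+ N * (volume b + e))%:E.
Proof.
move=> bP e0; pose l i := b.2 0 i - b.1 0 i.
have l0 i : 0 <= l i by rewrite subr_ge0.
have [s s0 prods] := prod_add_small l e0.
pose m i := (Num.truncn (l i / s)).+1; pose m1 := \max_i m i.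
have ms i : (m i)%:R * s <= l i + s.
  rewrite /m -natr1 mulrDl mul1r lerD2r -ler_pdivlMr //.
  by rewrite truncn_le divr_ge0 // ltW.
have mm1 i : (m i <= m1)%N by exact: leq_bigmax.
pose cells := (family (fun i : 'I_N => [pred j : 'I_m1 | (j < m i)%N]) :
  simpl_pred {ffun 'I_N -> 'I_m1}).
pose cell (c : {ffun 'I_N -> 'I_m1}) := A `&`
  [set x | forall i, b.1 0 i + (c i)%:R * s <= x 0 i <= b.1 0 i + (c i).+1%:R * s].
have card_cells : #|cells| = (\prod_i m i)%N.
  rewrite card_family foldrE big_map big_enum /=; apply: eq_bigr => i _.
  rewrite -sum1_card (eq_bigl (fun j : 'I_m1 => (j < m i)%N)) //.
  rewrite -(big_ord_widen _ (fun=> 1%N) (mm1 i)) sum1_card.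
  by rewrite card_ord.
have cell_cov c : c \in cells -> coverable (g @` cell c) ((2 * (L * s)) ^+ N)%:E.
  move=> _; have [[a ca]|no] := pselect (exists a, cell c a); last first.
    apply: coverableW (coverable0 R N_gt0); last first.
      by rewrite lee_fin exprn_ge0 // !mulr_ge0 // ltW.
    by move=> y [x cx gx]; apply: no; exists x.
  apply: coverableW (coverable_ball (g a) _); [|exact: lexx|]; last first.
    by rewrite mulr_ge0 // ltW.
  move=> _ [x cx <-] /=; apply: le_trans (g_lip cx.1 ca.1) _.
  rewrite ler_pM2l //; apply: norm_mx_le => [|k i]; first exact: ltW.
  rewrite (ord1 k) !mxE ler_norml; have /andP[x1 x2] := cx.2 i.
  have /andP[a1 a2] := ca.2 i.
  rewrite -natr1 mulrDl mul1r in x2 a2.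
  by apply/andP; split; lra.
have cells_cover : g @` (A `&` in_box b) `<=`
    \bigcup_(c in [set c | c \in cells]) (g @` cell c).
  move=> _ [x [Ax bx] <-].
  have q0 i : 0 <= (x 0 i - b.1 0 i) / s.
    by apply: divr_ge0; [rewrite subr_ge0; case/andP: (bx i) | exact: ltW].
  have jm i : (Num.truncn ((x 0 i - b.1 0 i) / s)%R < m i)%N.
    rewrite ltnS; apply: le_truncn.
    by rewrite ler_pM2r ?invr_gt0 // lerD2r; case/andP: (bx i).
  exists [ffun i => Ordinal (leq_trans (jm i) (mm1 i))].
    by apply/familyP => i; rewrite ffunE inE /=; exact: jm.
  exists x => //; split=> // i; rewrite ffunE /=.
  have := truncn_itv (q0 i); rewrite ler_pdivlMr // ltr_pdivrMr //.
  by rewrite -natr1 => /andP[? ?]; apply/andP; split; lra.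
have LN0 : 0 <= (2 * (L * s)) ^+ N by rewrite exprn_ge0 // !mulr_ge0 // ltW.
apply: coverableW cells_cover _ (coverable_bigcup_fin N_gt0 LN0 cell_cov).
rewrite lee_fin card_cells mulrA exprMn mulrCA ler_pM2l; last first.
  by rewrite exprn_gt0 // mulr_gt0.
apply: le_trans prods; rewrite natr_prod -[X in _ * s ^+ X](card_ord N).
rewrite -prodr_const -big_split /=; apply: ler_prod => i _.
by rewrite ms mulr_ge0 // ltW.
Qed.

Lemma lebesgue_null_lipschitz : lebesgue_null A -> lebesgue_null (g @` A).
Proof.
move=> /lebesgue_nullP nullA; apply/lebesgue_nullP => e e0.
pose K := (2 * L) ^+ N; have K0 : 0 < K by rewrite exprn_gt0 // mulr_gt0.
pose h := e / K / 2; have h0 : 0 < h by rewrite !divr_gt0.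
have [b [bP Ab sumle]] := nullA h h0.
have hk k : 0 < h / (2 ^ k.+1)%:R by rewrite divr_gt0 // ltr0n expn_gt0.
have := coverable_bigcup (fun k => coverable_lipschitz_box (bP k) (hk k)).
apply: coverableW.
  by move=> _ [x Ax <-]; have [k _ bx] := Ab x Ax; exists k => //; exists x.
under eq_eseriesr do rewrite EFinM.
rewrite nneseriesZl; last first.
  by move=> k _; rewrite lee_fin addr_ge0 ?volume_ge0 // ltW.
have -> : e = K * (h + h).
  by rewrite /h -splitr mulrC divfK // gt_eqF.
rewrite EFinM lee_pmul2l // EFinD.
apply: le_trans (leeD2r _ sumle).
under eq_eseriesr do rewrite EFinD.
by apply: epsilon_trick => [k|]; rewrite ?lee_fin ?volume_ge0 // ltW.
Qed.

End Lipschitz.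

(** * Polynomial maps *)

Section PolynomialMaps.
Variables (R : realType) (N : nat).
Local Notation mp := (mpoly N R).
Local Notation "''V'" := ('rV[R]_N).

Definition peval (x : 'V) (q : mp) : R := meval (fun i => x 0 i) q.

HB.instance Definition _ (x : 'V) :=
  GRing.RMorphism.copy (peval x) (meval (fun i => x 0 i)).

Lemma pevalC x c : peval x (mpolyC N c) = c.
Proof. exact: mevalC. Qed.

Lemma pevalX x i : peval x (mpolyX R (mnm1 i)) = x 0 i.
Proof. exact: mevalXU. Qed.

Lemma pevalZ x c q : peval x (c *: q) = c * peval x q.
Proof. exact: mevalZ. Qed.

Definition jac m (F : 'rV[mp]_m) : 'M[mp]_(N, m) :=
  \matrix_(i, j) mderiv i (F 0 j).

Definition evmx m n (x : 'V) (A : 'M[mp]_(m, n)) : 'M[R]_(m, n) :=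
  map_mx (peval x) A.

Lemma evmxM m n p x (A : 'M[mp]_(m, n)) (B : 'M[mp]_(n, p)) :
  evmx x (A *m B) = evmx x A *m evmx x B.
Proof. exact: map_mxM. Qed.

Lemma evmxD m n x (A B : 'M[mp]_(m, n)) :
  evmx x (A + B) = evmx x A + evmx x B.
Proof. exact: map_mxD. Qed.

Definition constmx m n (A : 'M[R]_(m, n)) : 'M[mp]_(m, n) :=
  map_mx (@mpolyC N R) A.

Lemma evmx_const m n x (A : 'M[R]_(m, n)) : evmx x (constmx A) = A.
Proof. by apply/matrixP => i j; rewrite !mxE pevalC. Qed.

Lemma jacM m n (F : 'rV[mp]_m) (A : 'M[R]_(m, n)) :
  jac (F *m constmx A) = jac F *m constmx A.
Proof.
apply/matrixP => i j; rewrite !mxE raddf_sum; apply: eq_bigr => k _.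
by rewrite !mxE /= mulrC mderiv_mulC mulrC.
Qed.

Lemma jacD m (F G : 'rV[mp]_m) : jac (F + G) = jac F + jac G.
Proof. by apply/matrixP => i j; rewrite !mxE raddfD. Qed.

Definition varmx : 'rV[mp]_N := \row_i mpolyX R (mnm1 i).

Lemma evmx_var x : evmx x varmx = x.
Proof. by apply/rowP => i; rewrite !mxE pevalX. Qed.

Lemma jac_var x : evmx x (jac varmx) = 1%:M.
Proof.
apply/matrixP => i j; rewrite !mxE mderivX mnm1E pevalZ eq_sym.
have [->|_] := eqVneq i j; last by rewrite mul0r.
have -> : mnm_sub (mnm1 j) (mnm1 j) = @mnm0 N.
  by apply/mnmP => k; rewrite mnmBE mnm0E subnn.
by rewrite mul1r /peval mevalX big1 // => k _; rewrite mnm0E expr0.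
Qed.

(** The analytic properties of polynomials that are used below.  They hold for
    constants and variables and survive sums and products. *)
Definition smooth_bounds (q : mp) : Prop := forall K : R, exists2 C : R, 0 <= C &
  forall x y : 'V, `|x| <= K -> `|y| <= K ->
    [/\ `|peval x q| <= C, `|peval y q - peval x q| <= C * `|y - x| &
      `|peval y q - peval x q - \sum_i (y - x) 0 i * peval x (mderiv i q)|
        <= C * `|y - x| ^+ 2].

Let smooth_boundsC c : smooth_bounds (mpolyC N c).
Proof.
move=> K; exists `|c| => // x y _ _; rewrite !pevalC subrr normr0; split=> //.
rewrite big1 ?subrr ?normr0 ?mulr_ge0 ?exprn_ge0 // => i _.
by rewrite mderivC rmorph0 mulr0.
Qed.

Let smooth_boundsX i : smooth_bounds (mpolyX R (mnm1 i)).
Proof.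
move=> K; exists (`|K| + 1); first by rewrite addr_ge0.
move=> x y xK yK; rewrite !pevalX.
have K1 : 1 <= `|K| + 1 by rewrite lerDr.
split.
- apply: le_trans (norm_entry x 0 i) _; apply: le_trans xK _.
  by apply: le_trans (ler_norm K) _; rewrite lerDl.
- have := norm_entry (y - x) 0 i; rewrite !mxE => /le_trans; apply.
  by rewrite ler_peMl.
rewrite (eq_bigr (fun j => (y - x) 0 j * evmx x (jac varmx) j i)); last first.
  by move=> j _; rewrite !mxE.
have -> : \sum_j (y - x) 0 j * evmx x (jac varmx) j i = (y - x) 0 i.
  have := congr1 (fun A : 'rV[R]_N => A 0 i) (mulmx1 (y - x)).
  by rewrite -(jac_var x) [LHS]mxE.
by rewrite !mxE subrr normr0 mulr_ge0 ?exprn_ge0 // addr_ge0.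
Qed.

Let smooth_boundsD p q :
  smooth_bounds p -> smooth_bounds q -> smooth_bounds (p + q).
Proof.
move=> sp sq K; have [C C0 pC] := sp K; have [D D0 qD] := sq K.
exists (C + D) => [|x y xK yK]; first exact: addr_ge0.
have [p0 p1 p2] := pC x y xK yK; have [q0 q1 q2] := qD x y xK yK.
rewrite !rmorphD /= !mulrDl; split.
- by apply: le_trans (ler_normD _ _) _; rewrite lerD.
- by rewrite opprD addrACA; apply: le_trans (ler_normD _ _) _; rewrite lerD.
under eq_bigr do rewrite mderivD rmorphD /= mulrDr.
rewrite big_split /=.
rewrite [X in `|X - _|](_ : _ = (peval y p - peval x p) + (peval y q - peval x q));
  last by ring.
rewrite opprD addrACA.
by apply: le_trans (ler_normD _ _) _; rewrite lerD.
Qed.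

Let smooth_boundsM p q :
  smooth_bounds p -> smooth_bounds q -> smooth_bounds (p * q).
Proof.
move=> sp sq K; have [C C0 pC] := sp K; have [D D0 qD] := sq K.
exists (C * D * (3 + `|K| *+ 2)).
  by rewrite !mulr_ge0 // addr_ge0 // mulrn_wge0.
move=> x y xK yK.
have [p0 p1 p2] := pC x y xK yK; have [q0 q1 q2] := qD x y xK yK.
have CD : 0 <= C * D by exact: mulr_ge0.
have dK : `|y - x| <= `|K| *+ 2.
  rewrite mulr2n; apply: le_trans (ler_normB _ _) _.
  by rewrite lerD // (le_trans _ (ler_norm K)).
have d0 : 0 <= `|y - x| by [].
set a := peval y p - peval x p in p1 p2; set b := peval y q - peval x q in q1 q2.
set A := \sum_i _ in p2; set B := \sum_i _ in q2.
set d := `|y - x| in p1 p2 q1 q2 dK d0 *.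
have K0 : 0 <= `|K| *+ 2 by rewrite mulrn_wge0.
have ab : `|a * b| <= C * D * d ^+ 2.
  rewrite normrM; apply: le_trans (ler_pM _ _ p1 q1) _ => //.
  by rewrite le_eqVlt; apply/orP; left; apply/eqP; ring.
have aq : `|a * peval x q| <= C * D * d.
  by rewrite normrM mulrAC ler_pM.
have pb : `|peval x p * b| <= C * D * d.
  by rewrite normrM -mulrA ler_pM.
have deltaE : peval y (p * q) - peval x (p * q) =
    a * peval x q + peval x p * b + a * b.
  by rewrite !rmorphM /= /a /b; ring.
split.
- rewrite rmorphM normrM; apply: le_trans (ler_pM _ _ p0 q0) _ => //.
  by rewrite ler_peMr //; apply: le_trans (_ : 3 <= _); rewrite ?lerDl ?ler1n.
- rewrite deltaE; apply: le_trans (ler_normD _ _) _.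
  apply: le_trans (lerD (ler_normD _ _) ab) _.
  apply: le_trans (lerD (lerD aq pb) (lexx _)) _.
  have : C * D * d ^+ 2 <= C * D * (`|K| *+ 2) * d.
    by rewrite expr2 mulrA ler_wpM2r // ler_wpM2l.
  have : 0 <= C * D * d by rewrite mulr_ge0.
  have -> : C * D * (3 + `|K| *+ 2) * d =
      C * D * d *+ 3 + C * D * (`|K| *+ 2) * d by ring.
  move: (C * D * d) (C * D * d ^+ 2) (C * D * (`|K| *+ 2) * d) => u v w.
  by move=> *; lra.
have -> : \sum_i (y - x) 0 i * peval x (mderiv i (p * q)) =
    A * peval x q + peval x p * B.
  rewrite mulr_suml mulr_sumr -big_split /=; apply: eq_bigr => i _.
  by rewrite mderivM rmorphD !rmorphM /=; ring.
rewrite deltaE.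
have -> : a * peval x q + peval x p * b + a * b -
    (A * peval x q + peval x p * B) =
    (a - A) * peval x q + peval x p * (b - B) + a * b by ring.
apply: le_trans (ler_normD _ _) _.
apply: le_trans (lerD (ler_normD _ _) ab) _.
have aq2 : `|(a - A) * peval x q| <= C * D * d ^+ 2.
  by rewrite normrM mulrAC ler_pM.
have pb2 : `|peval x p * (b - B)| <= C * D * d ^+ 2.
  by rewrite normrM -mulrA ler_pM.
apply: le_trans (lerD (lerD aq2 pb2) (lexx _)) _.
have -> : C * D * (3 + `|K| *+ 2) * d ^+ 2 = C * D * d ^+ 2 + C * D * d ^+ 2 +
    C * D * d ^+ 2 + C * D * (`|K| *+ 2) * d ^+ 2 by ring.
by rewrite lerDl !mulr_ge0 // exprn_ge0.
Qed.

Lemma smooth_boundsP q : smooth_bounds q.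
Proof.
have sX m : smooth_bounds (mpolyX R m).
  rewrite mpolyXE_id; elim/big_ind: _ => [||i _].
  - by rewrite -mpolyC1.
  - exact: smooth_boundsM.
  elim: (m _) => [|k IHk]; first by rewrite expr0 -mpolyC1.
  by rewrite exprS; apply: smooth_boundsM.
rewrite (mpolyE q); elim/big_ind: _ => [||m _].
- by rewrite -mpolyC0.
- exact: smooth_boundsD.
- by rewrite -mul_mpolyC; exact: smooth_boundsM.
Qed.

Lemma bounded_family (I : finType) (P : I -> R -> Prop) :
  (forall i C D, P i C -> C <= D -> P i D) ->
  (forall i, exists2 C, 0 <= C & P i C) ->
  exists2 C, 0 <= C & forall i, P i C.
Proof.
move=> Pmono PC.
have [C HC] : {C : I -> R & forall i, 0 <= C i /\ P i (C i)}.
  by apply: (@choice _ _ (fun i C => 0 <= C /\ P i C)) => i; case: (PC i) => C; exists C.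
exists (\sum_i C i) => [|i]; first by apply: sumr_ge0 => i _; case: (HC i).
apply: Pmono (HC i).2 _; rewrite (bigD1 i) //= lerDl.
by apply: sumr_ge0 => j _; case: (HC j).
Qed.

Lemma evmx_bounds m n (A : 'M[mp]_(m, n)) (K : R) : exists2 C : R, 0 <= C &
  forall x y : 'V, `|x| <= K -> `|y| <= K ->
    `|evmx x A| <= C /\ `|evmx y A - evmx x A| <= C * `|y - x|.
Proof.
have [||C C0 HC] := @bounded_family ('I_m * 'I_n)%type (fun ij C => forall x y : 'V,
    `|x| <= K -> `|y| <= K ->
    `|peval x (A ij.1 ij.2)| <= C /\
    `|peval y (A ij.1 ij.2) - peval x (A ij.1 ij.2)| <= C * `|y - x|).
- move=> ij C D HC CD x y xK yK; have [? h] := HC x y xK yK.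
  split; first exact: le_trans CD.
  by apply: le_trans h _; rewrite ler_wpM2r.
- move=> ij; have [C C0 HC] := smooth_boundsP (A ij.1 ij.2) K.
  by exists C => // x y xK yK; have [] := HC x y xK yK.
exists C => // x y xK yK; split.
  by apply: norm_mx_le => // i j; rewrite !mxE; have [] := HC (i, j) x y xK yK.
apply: norm_mx_le => [|i j]; first by rewrite mulr_ge0.
by rewrite !mxE; have [] := HC (i, j) x y xK yK.
Qed.

Lemma evmx_taylor m (F : 'rV[mp]_m) (K : R) : exists2 C : R, 0 <= C &
  forall x y : 'V, `|x| <= K -> `|y| <= K ->
    `|evmx y F - evmx x F - (y - x) *m evmx x (jac F)| <= C * `|y - x| ^+ 2.
Proof.
have [||C C0 HC] := @bounded_family 'I_m (fun j C => forall x y : 'V,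
    `|x| <= K -> `|y| <= K ->
    `|peval y (F 0 j) - peval x (F 0 j) -
      \sum_i (y - x) 0 i * peval x (mderiv i (F 0 j))| <= C * `|y - x| ^+ 2).
- move=> j C D HC CD x y xK yK; apply: le_trans (HC x y xK yK) _.
  by rewrite ler_wpM2r // exprn_ge0.
- move=> j; have [C C0 HC] := smooth_boundsP (F 0 j) K.
  by exists C => // x y xK yK; have [] := HC x y xK yK.
exists C => // x y xK yK.
apply: norm_mx_le => [|i j]; first by rewrite mulr_ge0 // exprn_ge0.
have -> : ((y - x) *m evmx x (jac F)) = \row_j \sum_i
    (y - x) 0 i * peval x (mderiv i (F 0 j)).
  by apply/rowP => k; rewrite !mxE; apply: eq_bigr => l _; rewrite !mxE.
by rewrite (ord1 i); have := HC j x y xK yK; congr (`|_| <= _); rewrite !mxE.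
Qed.

End PolynomialMaps.

(** * Zero sets of polynomials *)

(** Used to cut R^N into countably many cells of diameter at most r. *)
Lemma floor_eq_close (R : realType) (r a b : R) : 0 < r ->
  Num.floor (a / r) = Num.floor (b / r) -> `|a - b| <= r.
Proof.
move=> r0 ab; have := floor_itv (a / r); have := floor_itv (b / r).
rewrite ab !ler_pdivlMr // !ltr_pdivrMr // intrD mulrDl mulr1z mul1r.
rewrite ler_norml; move: ((Num.floor _)%:~R * r) => t.
by move=> /andP[? ?] /andP[? ?]; apply/andP; split; lra.
Qed.

Section NullZeroSets.
Variables (R : realType) (N : nat).
Hypothesis N_gt0 : (0 < N)%N.
Local Notation mp := (mpoly N R).
Local Notation "''V'" := ('rV[R]_N).

(** By [lebesgue_null_lipschitz], as the inverse of f on the image of S is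
    L-Lipschitz. *)
Lemma lebesgue_null_inv_lipschitz (S : set 'V) (f : 'V -> 'V) (L : R) :
  0 < L -> (forall x y, S x -> S y -> `|x - y| <= L * `|f x - f y|) ->
  lebesgue_null (f @` S) -> lebesgue_null S.
Proof.
move=> L0 flip nullfS.
pose g u := if pselect (exists2 x, S x & f x = u) is left P
  then projT1 (cid2 P) else 0.
have gP u : (f @` S) u -> S (g u) /\ f (g u) = u.
  rewrite /g; case: pselect => // P _; by case: (cid2 P).
apply: lebesgue_null_sub (lebesgue_null_lipschitz N_gt0 L0 _ nullfS) => [x Sx|].
  have fSx : (f @` S) (f x) by exists x.
  exists (f x) => //; have [Sg fg] := gP _ fSx; apply/eqP.
  rewrite -subr_eq0 -normr_le0; apply: le_trans (flip _ _ Sg Sx) _.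
  by rewrite fg subrr normr0 mulr0.
move=> u v fSu fSv; have [Su fu] := gP u fSu; have [Sv fv] := gP v fSv.
by rewrite -{2}fu -{2}fv; apply: flip.
Qed.

Lemma lebesgue_null_hyperplane i : lebesgue_null [set x : 'V | x 0 i = 0].
Proof.
pose b (k : nat) : 'V * 'V := (\row_j if j == i then 0 else - k%:R,
  \row_j if j == i then 0 else k%:R).
have bP k : proper_box (b k).
  by move=> j; rewrite !mxE; case: eqP => // _; rewrite ge0_cp.
apply: (@lebesgue_null_sub _ _ _ (\bigcup_k in_box (b k))) => [x /= xi0|].
  have [k xk] : exists k : nat, `|x| <= k%:R.
    by exists (Num.truncn `|x|).+1; rewrite ltW // truncnS_gt.
  exists k => // j; rewrite !mxE; case: eqP => [->|_]; first by rewrite xi0 lexx.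
  by rewrite -ler_norml (le_trans (norm_entry x 0 j)).
apply: lebesgue_null_bigcup => k; apply/lebesgue_nullP => e e0.
apply: coverableW (coverable_box N_gt0 (bP k)) => //.
by rewrite lee_fin /volume (bigD1 i) //= !mxE eqxx subrr mul0r ltW.
Qed.

(** Where the i-th partial derivative of q is bounded below, two nearby zeros of
    q cannot differ mostly in the i-th coordinate, by Taylor's formula.  So
    setting this coordinate to 0 has a Lipschitz inverse on the zeros in a small
    cell, and the image lies in a hyperplane. *)
Lemma lebesgue_null_zeros_nonsingular (q : mp) (i : 'I_N) :
  lebesgue_null [set x : 'V | peval x q = 0 /\ peval x (mderiv i q) != 0].
Proof.
pose Z (k l : nat) := [set x : 'V | [/\ `|x| <= k%:R, peval x q = 0
  & l.+1%:R^-1 <= `|peval x (mderiv i q)|]].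
apply: (@lebesgue_null_sub _ _ _ (\bigcup_(kl : nat * nat) Z kl.1 kl.2)).
  move=> x [qx dqx].
  exists ((Num.truncn `|x|).+1, Num.truncn `|peval x (mderiv i q)|^-1) => //.
  split=> //=; first by rewrite ltW // truncnS_gt.
  rewrite -[leRHS]invrK lef_pV2 ?posrE ?invr_gt0 ?normr_gt0 //.
  by rewrite ltW // truncnS_gt.
apply: (lebesgue_null_countable N_gt0) => -[k l] /=.
pose eta : R := l.+1%:R^-1; have eta0 : 0 < eta by rewrite invr_gt0.
have [C C0 HC] := smooth_boundsP q k%:R.
have [D D0 HD] := evmx_bounds (jac (\row_(j < 1) q)) k%:R.
pose r := eta / 2 / (C + 1).
have C1 : 0 < C + 1 by rewrite ltr_wpDl.
have r0 : 0 < r by rewrite !divr_gt0.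
have Cr : C * r <= eta / 2.
  by rewrite /r mulrCA ger_pMr ?divr_gt0 // ler_pdivrMr // mul1r lerDl.
pose piece (z : {ffun 'I_N -> int}) := Z k l `&`
  [set x : 'V | forall j, Num.floor (x 0 j / r) = z j].
apply: (@lebesgue_null_sub _ _ _ (\bigcup_z piece z)).
  move=> x Zx; exists [ffun j => Num.floor (x 0 j / r)] => //.
  by split=> // j; rewrite ffunE.
apply: (lebesgue_null_countable N_gt0) => z.
pose f (x : 'V) : 'V := \row_j if j == i then 0 else x 0 j.
(* From eta a <= eta / 2 (M + a) + N D M, where a is the i-th coordinate of the
   difference and M bounds the others. *)
pose L := 2 + 2 * N%:R * D / eta.
have L0 : 0 < L by rewrite /L ltr_wpDr // divr_ge0 ?(ltW eta0) // !mulr_ge0.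
apply: (@lebesgue_null_inv_lipschitz _ f L L0); last first.
  apply: lebesgue_null_sub (lebesgue_null_hyperplane i).
  by move=> u [x _ <-] /=; rewrite mxE eqxx.
move=> y x [[yk qy _] yz] [[xk qx dqx] xz].
set M := `|f y - f x|; have M0 : 0 <= M by exact: normr_ge0.
have offM j : j != i -> `|(y - x) 0 j| <= M.
  move=> ji; have := norm_entry (f y - f x) 0 j.
  by rewrite !mxE (negbTE ji).
have dr : `|y - x| <= r.
  apply: norm_mx_le => [|i0 j]; first exact: ltW.
  by rewrite !mxE (ord1 i0); apply: floor_eq_close; rewrite // yz xz.
have normD : `|y - x| <= M + `|(y - x) 0 i|.
  apply: norm_mx_le => [|i0 j]; first by rewrite addr_ge0.
  rewrite (ord1 i0); have [->|ji] := eqVneq j i; first by rewrite lerDr.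
  by rewrite (le_trans (offM j ji)) // lerDl.
have [_ _] := HC x y xk yk.
rewrite qy qx subr0 sub0r normrN (bigD1 i) //=.
set S := \sum_(j | j != i) _ => taylor.
have boundS : `|S| <= N%:R * D * M.
  apply: le_trans (ler_norm_sum _ _ _) _.
  apply: (@le_trans _ _ (\sum_(j < N) D * M)); last first.
    by rewrite sumr_const card_ord -[leLHS]mulr_natl mulrA.
  rewrite [leRHS](bigD1 i) //= ler_wpDl ?mulr_ge0 //.
  apply: ler_sum => j ji; rewrite normrM mulrC ler_pM // ?offM //.
  have [+ _] := HD x y xk yk; apply: le_trans.
  by have := norm_entry (evmx x (jac (\row_(_ < 1) q))) j 0; rewrite !mxE.
set a := `|(y - x) 0 i| in normD *.
have a0 : 0 <= a by exact: normr_ge0.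
have etaa : eta * a <= `|(y - x) 0 i * peval x (mderiv i q)|.
  by rewrite normrM mulrC ler_wpM2l.
have quad : C * `|y - x| ^+ 2 <= eta / 2 * (M + a).
  rewrite expr2 mulrA; apply: ler_pM => //; first by rewrite mulr_ge0.
  by apply: le_trans Cr; rewrite ler_wpM2l.
have key : eta * a <= eta / 2 * (M + a) + N%:R * D * M.
  apply: le_trans etaa _.
  have := ler_normB ((y - x) 0 i * peval x (mderiv i q) + S) S.
  rewrite addrK => /le_trans; apply; apply: lerD boundS.
  exact: le_trans taylor quad.
apply: le_trans normD _.
have eL : eta * L = eta * 2 + 2 * (N%:R * D).
  by rewrite /L mulrDr mulrCA divff ?mulr1 ?mulrA // gt_eqF.
rewrite -(ler_pM2l eta0) mulrA eL.
move: key; rewrite -/M; move: (N%:R * D) => ND; nra.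
Qed.

(** A variable that occurs in the leading monomial will do, as the
    characteristic is 0. *)
Lemma exists_mderiv_neq0 (q : mp) : (1 < mmeasure mdeg q)%N ->
  exists2 i, mderiv i q != 0 & (mmeasure mdeg (mderiv i q) < mmeasure mdeg q)%N.
Proof.
move=> q1; have q0 : q != 0 by apply: contraTneq q1 => ->; rewrite mmeasure0.
have degm := mlead_deg q0; set m := mlead q in degm.
have /eqP : mdeg m != 0%N by rewrite -degm ltnS lt0n in q1.
rewrite mdegE => /eqP; rewrite sum_nat_eq0 negb_forall => /existsP[i /= mi].
have mU : mnm_add (mnm_sub m (mnm1 i)) (mnm1 i) = m by rewrite submK // lep1mP.
exists i.
  apply/eqP => dq0; have := mcoeff_deriv i (mnm_sub m (mnm1 i)) q.
  rewrite dq0 mcoeff0 mU => /eqP; rewrite eq_sym mulrn_eq0 /=.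
  by rewrite mcoeff_eq0 mlead_supp.
rewrite -degm ltnS [X in (X <= _)%N]mmeasureE; apply/bigmax_leqP_seq => u.
rewrite mcoeff_msupp mcoeff_deriv mulrn_eq0 /= mcoeff_eq0 negbK => umsupp _.
by have := msize_mdeg_lt umsupp; rewrite mdegD mdeg1 addn1 -degm ltnS.
Qed.

(** By induction on the degree: a zero of q is a zero of some nonzero partial
    derivative, or a nonsingular zero. *)
Theorem lebesgue_null_zeros (q : mp) : q != 0 ->
  lebesgue_null [set x : 'V | peval x q = 0].
Proof.
have [d] := ubnP (mmeasure mdeg q); elim: d q => // d IHd q; rewrite ltnS => qd q0.
have [q1|q1] := leqP (mmeasure mdeg q) 1.
  apply: lebesgue_null_sub (@lebesgue_null_set0 R N N_gt0) => x /=.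
  rewrite (msize1_polyC q1) pevalC => qx0; apply/negP: q0.
  by rewrite (msize1_polyC q1) qx0 mpolyC0 eqxx.
have [i dq0 dqd] := exists_mderiv_neq0 q1.
have null1 := IHd _ (leq_trans dqd qd) dq0.
have null2 := lebesgue_null_zeros_nonsingular q i.
apply: lebesgue_null_sub (lebesgue_nullU N_gt0 null1 null2) => x /= qx.
by have [?|?] := eqVneq (peval x (mderiv i q)) 0; [left | right].
Qed.

Lemma peval_neq0_ball (q : mp) (x : 'V) (r : R) : q != 0 -> 0 < r ->
  exists2 y, `|y - x| <= r & peval y q != 0.
Proof.
move=> q0 r0; have [y yx qy] := not_lebesgue_null_ball x (lebesgue_null_zeros q0) r0.
by exists y => //; apply/eqP.
Qed.

(** In particular, the zeros of a nonzero polynomial do not fill the space. *)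
Lemma peval_inj (q : mp) : (forall x, peval x q = 0) -> q = 0.
Proof.
move=> q0; apply/eqP/negPn/negP => qN0.
by have [y _ /eqP] := peval_neq0_ball 0 qN0 ltr01.
Qed.

End NullZeroSets.

(** * Local inversion *)

(** Makes the row vectors a complete normed module, the setting of
    [banach_fixed_point]. *)
HB.instance Definition _ (R : realType) m n := Complete.on 'M[R]_(m, n).

Section LocalInverse.
Variables (R : realType) (N : nat).
Local Notation mp := (mpoly N R).
Local Notation "''V'" := ('rV[R]_N).

Definition near_identity (F : 'V -> 'V) (x0 : 'V) (r : R) : Prop :=
  forall x y, `|x - x0| <= r -> `|y - x0| <= r ->
    `|F y - F x - (y - x)| <= 2^-1 * `|y - x|.

Lemma near_identity_sub F x0 (r s : R) :
  s <= r -> near_identity F x0 r -> near_identity F x0 s.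
Proof. by move=> sr Fr x y xs ys; apply: Fr; exact: le_trans sr. Qed.

Lemma near_identity_lip F x0 r : near_identity F x0 r ->
  forall x y, `|x - x0| <= r -> `|y - x0| <= r ->
    `|y - x| <= 2 * `|F y - F x| /\ `|F y - F x| <= 2 * `|y - x|.
Proof.
move=> Fr x y xr yr; have := Fr x y xr yr.
set u := F y - F x; set v := y - x => uv.
have := ler_normD (u - v) v; have := ler_normD (v - u) u.
rewrite !subrK (distrC v); move: `|u - v| `|u| `|v| uv => a b c *.
by split; lra.
Qed.

Lemma closed_ball_mem (x0 x : 'V) (r : R) :
  closed_ball_ (@Num.norm R 'V) x0 r x = (`|x - x0| <= r) :> Prop.
Proof. by rewrite /closed_ball_ /= distrC. Qed.

(** A solution of F x = y is a fixed point of x |-> x - F x + y, which is a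
    contraction of the ball. *)
Lemma local_inverse F x0 r : 0 < r -> near_identity F x0 r ->
  forall y, `|y - F x0| <= r / 2 -> exists2 x, `|x - x0| <= r & F x = y.
Proof.
move=> r0 Fr y yr; pose f x := x - F x + y.
pose U := closed_ball_ (@Num.norm R 'V) x0 r.
have x0r : `|x0 - x0| <= r by rewrite subrr normr0 ltW.
have fU : {homo f : x / U x >-> U x}.
  move=> x; rewrite /U !closed_ball_mem => xr.
  have -> : f x - x0 = - (F x - F x0 - (x - x0)) + (y - F x0).
    by rewrite /f; apply/rowP => i; rewrite !mxE; ring.
  apply: le_trans (ler_normD _ _) _; rewrite normrN.
  have := Fr x0 x x0r xr; move: `|F x - F x0 - _| `|y - _| `|x - x0| yr xr => a b c.
  by move=> *; lra.
have [|||x] := @banach_fixed_point R 'V U (mkfun_fun fU).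
- exists (2^-1)%:nng; split=> [|[x z] [/= Ux Uz]]; first by rewrite /= invf_lt1 // ltr1n.
  move: Ux Uz; rewrite /U !closed_ball_mem /mkfun => xr yr'.
  have -> : f x - f z = - (F x - F z - (x - z)).
    by rewrite /f; apply/rowP => i; rewrite !mxE; ring.
  by rewrite normrN; exact: Fr.
- exact: closed_closed_ball_.
- by exists x0; rewrite /U closed_ball_mem.
rewrite /U closed_ball_mem => xr /= fx; exists x => //.
have : f x - x = 0 by rewrite {2}fx /mkfun subrr.
have -> : f x - x = y - F x by rewrite /f; apply/rowP => i; rewrite !mxE; ring.
by move/eqP; rewrite subr_eq0 => /eqP.
Qed.

Lemma jac_near_identity (F : 'rV[mp]_N) (x0 : 'V) :
  evmx x0 (jac F) = 1%:M ->
  exists2 r : R, 0 < r & near_identity (fun x => evmx x F) x0 r.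
Proof.
move=> J1; pose K := `|x0| + 1.
have inK x (r : R) : r <= 1 -> `|x - x0| <= r -> `|x| <= K.
  move=> r1 xr; rewrite -(subrK x0 x) addrC.
  by apply: le_trans (ler_normD _ _) _; rewrite lerD // (le_trans xr).
have [C C0 HC] := evmx_taylor F K.
have [D D0 HD] := evmx_bounds (jac F) K.
pose B := 2 * (2 * C + N%:R * D) + 1.
have B1 : 1 <= B by rewrite lerDr !mulr_ge0 // addr_ge0 ?mulr_ge0.
have B0 : 0 < B by exact: lt_le_trans B1.
have r1 : B^-1 <= 1 by rewrite invf_le1.
exists B^-1; first by rewrite invr_gt0.
move=> x y xr yr; have xK := inK x _ r1 xr; have yK := inK y _ r1 yr.
have x0K : `|x0| <= K by rewrite lerDl.
have -> : evmx y F - evmx x F - (y - x) =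
    (evmx y F - evmx x F - (y - x) *m evmx x (jac F)) +
    (y - x) *m (evmx x (jac F) - 1%:M).
  by rewrite mulmxBr mulmx1 addrA subrK.
apply: le_trans (ler_normD _ _) _.
apply: le_trans (lerD (HC x y xK yK) (norm_mulmx _ _)) _.
have [_] := HD x0 x x0K xK; rewrite J1 => HJ.
have dr : `|y - x| <= 2 * B^-1.
  have := ler_normB (y - x0) (x - x0); rewrite opprB addrA subrK => /le_trans.
  by apply; rewrite mulr_natl mulr2n lerD.
have d0 : 0 <= `|y - x| by exact: normr_ge0.
have t1 : C * `|y - x| ^+ 2 <= 2 * C * B^-1 * `|y - x|.
  by rewrite expr2 mulrA ler_wpM2r // [2 * C]mulrC -mulrA ler_wpM2l.
have t2 : N%:R * `|y - x| * `|evmx x (jac F) - 1%:M| <= N%:R * D * B^-1 * `|y - x|.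
  rewrite mulrAC ler_wpM2r // -mulrA ler_wpM2l //.
  by apply: le_trans HJ _; rewrite ler_wpM2l.
apply: le_trans (lerD t1 t2) _; rewrite -mulrDl ler_wpM2r // -mulrDl.
by rewrite ler_pdivrMr // /B mulrDr mulrA mulVf ?mul1r ?lerDl ?mulr1 ?invr_ge0.
Qed.

End LocalInverse.

(** * Fibres of polynomial maps *)

Lemma exists_reflexive_inverse (F : fieldType) n m (A : 'M[F]_(n, m)) :
  exists2 L : 'M[F]_(m, n), (A *m L *m A = A) & (L *m A *m L = L).
Proof.
have : A *m pinvmx A *m A = A by exact: mulmxKpV.
move: (pinvmx A) => p pP; exists (p *m A *m p); first by rewrite !mulmxA !pP.
have pp : p *m A *m p *m A = p *m A by rewrite -[in RHS]pP !mulmxA.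
by rewrite !mulmxA !pp.
Qed.

(** If the rank does not increase from G0 to G, then G is determined by G *m L,
    with a bound that is locally uniform as E is near the identity when G is near
    G0.  Indeed E *m (G0 *m L) = G *m L, so G *m L has the rank of G0 as E is
    invertible.  Hence G and G *m L have the same left kernel, and it contains the
    rows of (1 - G0 *m L) *m invmx E = 1 - G *m L *m invmx E. *)
Lemma rank_factor (F : fieldType) n m (G0 G : 'M[F]_(n, m)) (L : 'M[F]_(m, n)) :
  G0 *m L *m G0 = G0 -> L *m G0 *m L = L ->
  let E := 1%:M - G0 *m L + G *m L in
  (\rank G <= \rank G0)%N -> E \in unitmx -> G = G *m L *m invmx E *m G.
Proof.
move=> PG0 LG0L E rG Eu; pose P := G0 *m L.
have PP : P *m P = P by rewrite {2}/P mulmxA PG0.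
have LP : L *m P = L by rewrite mulmxA.
have EP : E *m P = G *m L.
  by rewrite /E mulmxDl mulmxBl mul1mx -/P PP subrr add0r -mulmxA LP.
have EQ : E *m (1%:M - P) = 1%:M - P.
  rewrite mulmxBr mulmx1 EP /E -/P; apply/matrixP => i j; rewrite !mxE; ring.
pose X := (1%:M - P) *m invmx E.
have XGL : X *m (G *m L) = 0.
  by rewrite -EP mulmxA /X mulmxKV // mulmxBl mul1mx PP subrr.
have rGL : \rank (G *m L) = \rank G0.
  rewrite -EP eqmxMfull ?row_full_unit //.
  apply/eqP; rewrite eqn_leq; apply/andP; split; first exact: mxrankM_maxl.
  by rewrite -{1}PG0 mxrankM_maxl.
have kerGL : (kermx (G *m L) <= kermx G)%MS.
  have sub : (kermx G <= kermx (G *m L))%MS.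
    by apply/sub_kermxP; rewrite mulmxA mulmx_ker mul0mx.
  rewrite -(mxrank_leqif_sup sub) !mxrank_ker rGL.
  apply/eqP; congr (_ - _)%N; apply/eqP; rewrite eqn_leq rG /= -rGL.
  exact: mxrankM_maxl.
have XG : X *m G = 0 by apply/sub_kermxP/(submx_trans _ kerGL)/sub_kermxP.
have XE : 1%:M - G *m L *m invmx E = X.
  rewrite /X -{1}(mulmxV Eu) -mulmxBl; congr (_ *m _).
  by rewrite /E addrK.
by apply/eqP; rewrite -subr_eq0 -{1}(mul1mx G) -mulmxBl XE XG.
Qed.

Section Analysis.
Variable R : realType.

(** Subdivide the interval in n parts and let n grow. *)
Lemma quadratic_variation_cst m (u : R -> 'rV[R]_m) (C t : R) : 0 <= t ->
  (forall r s, 0 <= r <= t -> 0 <= s <= t -> `|u s - u r| <= C * (s - r) ^+ 2) ->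
  u t = u 0.
Proof.
move=> t0 uC; apply/eqP; rewrite -subr_eq0 -normr_le0.
have Ct : 0 <= C * t ^+ 2.
  have := uC 0 t; rewrite subr0 !lexx t0 => /(_ isT isT).
  exact: le_trans (normr_ge0 _).
have step (n : nat) : `|u t - u 0| <= C * t ^+ 2 / n.+1%:R.
  pose s k := k%:R / n.+1%:R * t.
  have sn : s n.+1 = t by rewrite /s divff ?mul1r.
  have s0t k : (k <= n.+1)%N -> 0 <= s k <= t.
    move=> kn; rewrite /s mulr_ge0 ?divr_ge0 //= ler_piMl //.
    by rewrite ler_pdivrMr // mul1r ler_nat.
  have -> : u t - u 0 = \sum_(k < n.+1) (u (s k.+1) - u (s k)).
    rewrite -(big_mkord xpredT (fun k => u (s k.+1) - u (s k))).
    by rewrite (telescope_sumr (u \o s)) //= sn /s mul0r mul0r.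
  apply: le_trans (ler_norm_sum _ _ _) _.
  apply: (@le_trans _ _ (\sum_(k < n.+1) C * t ^+ 2 / n.+1%:R ^+ 2)).
    apply: ler_sum => k _; apply: le_trans (uC _ _ _ _) _; rewrite ?s0t //.
      by rewrite ltnW.
    have -> : s k.+1 - s k = t / n.+1%:R.
      rewrite /s -mulrBl -mulrBl -[in k.+1%:R]addn1 natrD [_ + 1]addrC addrK.
      by rewrite mulrC mul1r.
    by rewrite expr_div_n mulrA.
  rewrite sumr_const card_ord -[leLHS]mulr_natr le_eqVlt; apply/orP; left.
  by apply/eqP; field.
rewrite leNgt; apply/negP => d0; set d := `|_| in d0 step.
pose n := Num.truncn (C * t ^+ 2 / d).
have := step n; rewrite ler_pdivlMr // mulrC -ler_pdivlMr //.
by rewrite leNgt truncnS_gt.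
Qed.

End Analysis.

Section Fibres.
Variables (R : realType) (N : nat).
Local Notation mp := (mpoly N R).
Local Notation "''V'" := ('rV[R]_N).

Definition grad (f : mp) : 'M[mp]_(N, 1) := jac (\row_(_ < 1) f).

Section Straightening.
Variables (m : nat) (c : 'rV[mp]_m) (x0 : 'V).
Let G0 := evmx x0 (jac c).
Variable L : 'M[R]_(m, N).
Hypothesis PG0 : G0 *m L *m G0 = G0.
Hypothesis LG0L : L *m G0 *m L = L.

Let P := G0 *m L.

Let PP : P *m P = P.
Proof. by rewrite {2}/P mulmxA PG0. Qed.

Let LP : L *m P = L.
Proof. by rewrite mulmxA. Qed.

(** Coordinates F around x0 in which, along lines of direction v, the part
    c *m L of c is constant and f grows at unit speed.  With P = G0 *m L, a
    projection, F is made of c *m L (on the image of P), of f (on the line v) and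
    of the linear coordinate x *m Q; the last factor T normalises the derivative
    at x0.  It fixes v because v *m P = 0. *)
Lemma straighten (f : mp) (v : 'V) :
  v *m G0 = 0 -> v *m evmx x0 (grad f) = 1%:M ->
  exists2 F : 'rV[mp]_N, evmx x0 (jac F) = 1%:M &
    forall p q t, evmx q F - evmx p F = t *: v ->
      (evmx q c - evmx p c) *m L = 0 /\ peval q f - peval p f = t.
Proof.
set g0 := evmx x0 (grad f) => vG0 vg0.
have vP : v *m P = 0 by rewrite /P mulmxA vG0 mul0mx.
pose T := 1%:M - P *m g0 *m v.
have TK : T *m (1%:M + P *m g0 *m v) = 1%:M.
  rewrite /T mulmxDr mulmx1 mulmxBl mul1mx.
  rewrite -[P *m g0 *m v *m _]mulmxA (mulmxA v) (mulmxA v) vP !mul0mx mulmx0 subr0.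
  by rewrite subrK.
have TK' : (1%:M + P *m g0 *m v) *m T = 1%:M.
  rewrite /T mulmxBr mulmx1 mulmxDl mul1mx.
  rewrite -[P *m g0 *m v *m _]mulmxA (mulmxA v) (mulmxA v) vP !mul0mx mulmx0 addr0.
  by rewrite addrK.
pose Q := (1%:M - P) *m (1%:M - g0 *m v).
pose F := (c *m constmx N L + (\row_(_ < 1) f) *m constmx N v +
  varmx R N *m constmx N Q) *m constmx N T.
exists F.
  rewrite /F jacM !jacD !jacM !(evmxM, evmxD, evmx_const) jac_var mul1mx.
  rewrite -/G0 -/P -/(grad f) -/g0.
  have -> : P + g0 *m v + Q = 1%:M + P *m g0 *m v; last exact: TK'.
  rewrite /Q mulmxBr mulmx1 mulmxBl mul1mx mulmxA.
  by apply/matrixP => i j; rewrite !mxE; ring.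
move=> p q t.
set dc := evmx q c - evmx p c; set df := peval q f - peval p f.
have -> : evmx q F - evmx p F = (dc *m L + df *: v + (q - p) *m Q) *m T.
  rewrite /F !(evmxM, evmxD, evmx_const, evmx_var) -mulmxBl; congr (_ *m T).
  rewrite /dc !mulmxBl.
  have E x : evmx x (\row_(_ < 1) f) *m v = peval x f *: v.
    by apply/rowP => j; rewrite !mxE big_ord1 !mxE.
  by rewrite !E scalerBl; apply/rowP => j; rewrite !mxE; ring.
move=> /(congr1 (mulmxr (1%:M + P *m g0 *m v))) /=.
rewrite -mulmxA TK mulmx1 -scalemxAl mulmxDr mulmx1.
rewrite [v *m (P *m g0 *m v)]mulmxA [v *m (P *m g0)]mulmxA vP !mul0mx addr0 => W.
have QP : Q *m P = 0.
  rewrite /Q -mulmxA [(1%:M - g0 *m v) *m _]mulmxBl mul1mx -(mulmxA g0) vP mulmx0 subr0.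
  by rewrite mulmxBl mul1mx PP subrr.
have Qg0 : Q *m g0 = 0.
  rewrite /Q -mulmxA [(1%:M - g0 *m v) *m _]mulmxBl mul1mx -(mulmxA g0).
  by rewrite vg0 mulmx1 subrr mulmx0.
have dcL : dc *m L = 0.
  move/(congr1 (mulmxr P)): (W) => /=.
  rewrite 2!mulmxDl -[dc *m L *m P]mulmxA LP -[(q - p) *m Q *m P]mulmxA QP mulmx0.
  by rewrite addr0 -!scalemxAl vP !scaler0 addr0.
split=> //; move/(congr1 (mulmxr g0)): W => /=.
rewrite 2!mulmxDl dcL mul0mx add0r -[(q - p) *m Q *m g0]mulmxA Qg0 mulmx0 addr0.
rewrite -!scalemxAl vg0.
by move/matrixP/(_ 0 0); rewrite !mxE mulr1 mulr1.
Qed.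

(** By [rank_factor] the derivative of c at x in the direction y - x is controlled
    by that of c *m L, which is quadratically small when c *m L takes equal values
    at x and y. *)
Lemma fibre_variation :
  (forall x, (\rank (evmx x (jac c)) <= \rank G0)%N) ->
  exists2 r : R, 0 < r & exists2 C : R, 0 <= C & forall x y,
    `|x - x0| <= r -> `|y - x0| <= r -> (evmx y c - evmx x c) *m L = 0 ->
    `|evmx y c - evmx x c| <= C * `|y - x| ^+ 2.
Proof.
move=> rank_max; pose K := `|x0| + 1.
have inK x (r : R) : r <= 1 -> `|x - x0| <= r -> `|x| <= K.
  move=> r1 xr; rewrite -(subrK x0 x) addrC.
  by apply: le_trans (ler_normD _ _) _; rewrite lerD // (le_trans xr).
have x0K : `|x0| <= K by rewrite lerDl.
pose GL := jac c *m constmx N L.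
have GLE x : evmx x GL = evmx x (jac c) *m L by rewrite evmxM evmx_const.
have [C C0 HC] := evmx_taylor c K.
have [D D0 HD] := evmx_bounds GL K.
have [D' D'0 HD'] := evmx_bounds (jac c) K.
pose B := 2 * (N%:R * D) + 1.
have B1 : 1 <= B by rewrite lerDr !mulr_ge0.
have B0 : 0 < B by exact: lt_le_trans B1.
have r1 : B^-1 <= 1 by rewrite invf_le1.
exists B^-1; first by rewrite invr_gt0.
exists (N%:R * (2 * (m%:R * C * `|L|)) * D' + C).
  by rewrite addr_ge0 // !mulr_ge0.
move=> x y xr yr dcL; have xK := inK x _ r1 xr; have yK := inK y _ r1 yr.
set G := evmx x (jac c).
pose E := 1%:M - P + G *m L.
have Ebound (h : 'V) : `|h| <= 2 * `|h *m E|.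
  have hE : h = h *m E - h *m (E - 1%:M) by rewrite mulmxBr mulmx1 subKr.
  have : `|h *m (E - 1%:M)| <= 2^-1 * `|h|.
    apply: le_trans (norm_mulmx _ _) _; rewrite mulrAC ler_wpM2r //.
    have [_] := HD x0 x x0K xK; rewrite !GLE -/G0 -/P -/G => HE.
    have -> : E - 1%:M = G *m L - P by rewrite /E addrC addrA addrA addNr add0r addrC.
    apply: (@le_trans _ _ (N%:R * (D * B^-1))).
      by rewrite ler_wpM2l // (le_trans HE) // ler_wpM2l.
    by rewrite mulrA ler_pdivrMr // /B; move: (N%:R * D) => ND; lra.
  have := ler_normB (h *m E) (h *m (E - 1%:M)); rewrite -hE.
  by move: `|h| `|h *m E| `|h *m (E - _)| => a b d *; lra.
have Eunit : E \in unitmx.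
  rewrite -row_free_unit; apply: row_free_inj => h hE.
  by apply/eqP; rewrite -normr_le0 (le_trans (Ebound h)) // hE normr0 mulr0.
have GE := rank_factor PG0 LG0L (rank_max x) Eunit.
pose e := evmx y c - evmx x c - (y - x) *m G.
have eC : `|e| <= C * `|y - x| ^+ 2 by exact: HC.
have dcE : evmx y c - evmx x c = (y - x) *m G + e.
  by rewrite /e [RHS]addrC subrK.
pose w := (y - x) *m G *m L *m invmx E.
have wE : w *m E = - (e *m L).
  rewrite /w mulmxKV //; apply/eqP; rewrite -subr_eq0 opprK -mulmxDl -dcE.
  by rewrite dcL.
have wC : `|w| <= 2 * (m%:R * C * `|L|) * `|y - x| ^+ 2.
  apply: le_trans (Ebound w) _; rewrite wE normrN -mulrA ler_pM2l //.
  apply: le_trans (norm_mulmx _ _) _; rewrite -!mulrA ler_wpM2l //.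
  by rewrite [leRHS]mulrCA [leLHS]mulrC ler_wpM2l.
rewrite dcE; apply: le_trans (ler_normD _ _) _; rewrite mulrDl lerD //.
have -> : (y - x) *m G = w *m G.
  by rewrite [LHS](congr1 (mulmx (y - x)) GE) /w !mulmxA.
apply: le_trans (norm_mulmx _ _) _.
apply: (@le_trans _ _ (N%:R * (2 * (m%:R * C * `|L|) * `|y - x| ^+ 2) * D')).
  have [GD _] := HD' x x xK xK.
  by apply: ler_pM => //; rewrite ler_wpM2l.
by rewrite le_eqVlt; apply/orP; left; apply/eqP; ring.
Qed.

End Straightening.
End Fibres.

Section FibreTheorem.
Variables (R : realType) (N : nat).
Hypothesis N_gt0 : (0 < N)%N.
Local Notation mp := (mpoly N R).
Local Notation "''V'" := ('rV[R]_N).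

(** At a point where the rank is maximal, a tangent direction v of the fibre
    of c along which f varies gives, in the coordinates of [straighten], segments
    of direction v on which c is constant and f is injective.  Countably many
    translations along v of the image of Z in these coordinates do not fill a
    ball, so some segment starts outside Z and meets the complement of Z
    in points that converge to its origin. *)
Lemma fibre_curve m (c : 'rV[mp]_m) (f : mp) (x0 v : 'V) (Z : set 'V) :
  (forall x, (\rank (evmx x (jac c)) <= \rank (evmx x0 (jac c)))%N) ->
  v *m evmx x0 (jac c) = 0 -> v *m evmx x0 (grad f) = 1%:M ->
  lebesgue_null Z ->
  exists p, exists q : nat -> 'V,
    [/\ ~ Z p, forall k, ~ Z (q k), forall k, evmx (q k) c = evmx p c,
        injective (fun k => peval (q k) f)
      & forall e : R, 0 < e -> exists K, forall k, (K <= k)%N -> `|q k - p| < e].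
Proof.
move=> rank_max vG0 vg0 nullZ.
have [L PG0 LG0L] := exists_reflexive_inverse (evmx x0 (jac c)).
have [F F1 Fv] := straighten PG0 LG0L vG0 vg0.
have [r1 r10 F1r] := jac_near_identity F1.
have [r2 r20 [C C0 HC]] := fibre_variation PG0 LG0L rank_max.
pose r := Num.min r1 r2.
have r0 : 0 < r by rewrite lt_min r10.
pose G (x : 'V) := evmx x F.
have Gr : near_identity G x0 r by apply: near_identity_sub F1r; rewrite ge_min lexx.
have rr2 : r <= r2 by rewrite ge_min lexx orbT.
pose y0 := G x0.
have [phi phiP] : {phi : 'V -> 'V & forall y, `|y - y0| <= r / 2 ->
    `|phi y - x0| <= r /\ G (phi y) = y}.
  apply: (@choice _ _ (fun y x => `|y - y0| <= r / 2 -> `|x - x0| <= r /\ G x = y)).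
  move=> y; have [yr|yr] := pselect (`|y - y0| <= r / 2); last by exists 0.
  by have [x xr Gx] := local_inverse r0 Gr yr; exists x.
have phi_lip y z : `|y - y0| <= r / 2 -> `|z - y0| <= r / 2 ->
    `|phi z - phi y| <= 2 * `|z - y| /\ `|z - y| <= 2 * `|phi z - phi y|.
  move=> yr zr; have [yr' Gy] := phiP y yr; have [zr' Gz] := phiP z zr.
  by have := near_identity_lip Gr yr' zr'; rewrite Gy Gz.
pose bad := [set y | `|y - y0| <= r / 2 /\ Z (phi y)].
have null_bad : lebesgue_null bad.
  apply: (@lebesgue_null_inv_lipschitz _ _ N_gt0 bad phi 2) => // [y z [yr _] [zr _]|].
    by have [] := phi_lip z y zr yr.
  by apply: lebesgue_null_sub nullZ => x [y [_ Zy] <-].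
(* Segments of length t0 that start within r / 4 of y0 stay within r / 2. *)
pose t0 := r / 4 / (`|v| + 1).
have v1 : 0 < `|v| + 1 by rewrite ltr_wpDl.
have t00 : 0 < t0 by rewrite !divr_gt0.
have t0v : t0 * `|v| <= r / 4.
  by rewrite /t0 mulrAC ler_pdivrMr // ler_wpM2l ?lerDl // divr_ge0 // ltW.
pose t (k : nat) := t0 / k.+1%:R.
have tk0 k : 0 < t k by rewrite divr_gt0.
have tkt0 k : t k <= t0.
  by rewrite /t ler_pdivrMr // ler_peMr ?ler1n // ltW.
pose badk k := [set y | bad (y + t k *: v)].
have null_badk k : lebesgue_null (badk k).
  apply: (@lebesgue_null_inv_lipschitz _ _ N_gt0 _ (fun y => y + t k *: v) 1) => //.
    by move=> y z _ _; rewrite mul1r opprD addrACA subrr addr0.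
  by apply: lebesgue_null_sub null_bad => x [y yb <-].
have r4 : 0 < r / 4 by rewrite divr_gt0.
have [y yr ybad] := not_lebesgue_null_ball y0
  (lebesgue_nullU N_gt0 null_bad (lebesgue_null_bigcup null_badk)) r4.
have yV s : 0 <= s <= t0 -> `|y + s *: v - y0| <= r / 2.
  case/andP=> s0 st0; rewrite addrAC; apply: le_trans (ler_normD _ _) _.
  have : `|s *: v| <= r / 4.
    rewrite normrZ ger0_norm //; apply: le_trans t0v.
    by rewrite ler_wpM2r.
  by move: `|y - y0| `|s *: v| yr => a b *; lra.
have yr2 : `|y - y0| <= r / 2.
  by have := yV 0; rewrite scale0r addr0 lexx ltW //; apply.
have tk k : 0 <= t k <= t0 by rewrite (ltW (tk0 k)) tkt0.
pose q k := phi (y + t k *: v).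
have GqE (s s' : R) : 0 <= s <= t0 -> 0 <= s' <= t0 ->
    G (phi (y + s' *: v)) - G (phi (y + s *: v)) = (s' - s) *: v.
  move=> /yV ys /yV ys'; rewrite (phiP _ ys).2 (phiP _ ys').2.
  by rewrite opprD addrACA subrr add0r scalerBl.
have zero_in : 0 <= (0 : R) <= t0 by rewrite lexx ltW.
have phi0 : phi (y + 0 *: v) = phi y by rewrite scale0r addr0.
exists (phi y), q; split.
- by move=> Zy; apply: ybad; left.
- by move=> k Zq; apply: ybad; right; exists k => //; split=> //; apply: yV.
- move=> k; rewrite -phi0.
  apply: (@quadratic_variation_cst R m (fun s => evmx (phi (y + s *: v)) c)
    (C * (2 * `|v|) ^+ 2) (t k)); first exact: ltW.
  move=> s s' /andP[s0 sk] /andP[s'0 s'k].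
  have sI : 0 <= s <= t0 by rewrite s0 (le_trans sk).
  have s'I : 0 <= s' <= t0 by rewrite s'0 (le_trans s'k).
  have [dcL _] := Fv _ _ _ (GqE s s' sI s'I).
  have [ys _] := phiP _ (yV s sI); have [ys' _] := phiP _ (yV s' s'I).
  apply: le_trans (HC _ _ (le_trans ys rr2) (le_trans ys' rr2) dcL) _.
  rewrite -mulrA -exprMn ler_wpM2l //.
  have [+ _] := phi_lip _ _ (yV s sI) (yV s' s'I).
  rewrite opprD addrACA subrr add0r -scalerBl normrZ => lip.
  rewrite -[leRHS]real_normK ?num_real // ler_sqr ?nnegrE //.
  by rewrite normrM ger0_norm ?mulr_ge0 // mulrAC -mulrA.
- move=> k l /= fkl; have [_ kE] := Fv _ _ _ (GqE 0 (t k) zero_in (tk k)).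
  have [_ lE] := Fv _ _ _ (GqE 0 (t l) zero_in (tk l)).
  have : t k = t l by rewrite -[t k]subr0 -[t l]subr0 -kE -lE fkl.
  rewrite /t => /(mulfI (lt0r_neq0 t00)) /invr_inj /eqP.
  by rewrite eqr_nat eqSS => /eqP.
move=> e e0; pose K := Num.truncn (2 * t0 * `|v| / e); exists K => k Kk.
have [+ _] := phi_lip _ _ yr2 (yV _ (tk k)).
rewrite addrAC subrr add0r normrZ (ger0_norm (ltW (tk0 k))) => /le_lt_trans; apply.
have h : 2 * t0 * `|v| / e < k.+1%:R.
  by apply: lt_le_trans (truncnS_gt _) _; rewrite ler_nat ltnS.
have -> : 2 * (t k * `|v|) = 2 * t0 * `|v| / k.+1%:R by rewrite /t; ring.
by move: h; rewrite !ltr_pdivrMr // [e * _]mulrC.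
Qed.

(** Otherwise [fibre_curve] gives infinitely many points of a fibre near a point
    of the complement of Z, with pairwise distinct values of f. *)
Theorem finite_fibre_gradient m (c : 'rV[mp]_m) (f : mp) (Z : set 'V) :
  lebesgue_null Z ->
  (forall p, ~ Z p -> exists2 U, nbhs p U & finite_set [set peval q f | q in
    [set q | [/\ U q, ~ Z q & evmx q c = evmx p c]]]) ->
  forall x0, (forall x, (\rank (evmx x (jac c)) <= \rank (evmx x0 (jac c)))%N) ->
  forall v : 'V, v *m evmx x0 (jac c) = 0 -> v *m evmx x0 (grad f) = 0.
Proof.
move=> nullZ finf x0 rank_max v vc; apply/eqP/negPn/negP => vf.
pose s := (v *m evmx x0 (grad f)) 0 0.
have vfE : v *m evmx x0 (grad f) = s%:M by rewrite [LHS]mx11_scalar.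
have s0 : s != 0 by apply: contraNneq vf => s0; rewrite vfE s0 raddf0.
have [||p [q [Zp Zq cq fq qp]]] := @fibre_curve m c f x0 (s^-1 *: v) Z rank_max _ _ nullZ.
- by rewrite -scalemxAl vc scaler0.
- by rewrite -scalemxAl vfE scale_scalar_mx mulVf.
have [U /nbhs_ballP[e /= e0 eU]] := finf p Zp.
have [K qK] := qp e e0.
set S := (X in finite_set X) => finS.
have fU k : S (peval (q (k + K)%N) f).
  exists (q (k + K)%N) => //; split; [|exact: Zq|exact: cq].
  by apply: eU; rewrite -ball_normE /= distrC qK // leq_addl.
have /= := @finite_preimage nat R S (fun k => peval (q (k + K)%N) f) _ finS.
suff -> : (fun k => peval (q (k + K)%N) f) @^-1` S = setT.
  by move=> /(_ _)/infinite_nat; apply => k l _ _ /fq /addIn.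
by rewrite predeqE => k; split=> // _; exact: fU.
Qed.

(** A linear image of c is near the identity around x0. *)
Lemma full_rank_locally_injective m (c : 'rV[mp]_m) (L : 'M[R]_(m, N)) (x0 : 'V) :
  evmx x0 (jac c) *m L \in unitmx ->
  exists2 U, nbhs x0 U & set_inj U (fun x => evmx x c).
Proof.
move=> Lu; pose A := L *m invmx (evmx x0 (jac c) *m L).
have [|r r0 Fr] := @jac_near_identity R N (c *m constmx N A) x0.
  by rewrite jacM evmxM evmx_const mulmxA mulmxV.
exists [set x | `|x - x0| <= r].
  apply/nbhs_ballP; exists r => // x; rewrite -ball_normE /= distrC; exact: ltW.
move=> x y /[!inE] /= xr yr cxy; apply/eqP; rewrite eq_sym -subr_eq0 -normr_le0.
have [+ _] := near_identity_lip Fr xr yr => /le_trans; apply.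
rewrite !evmxM !evmx_const.
have -> : evmx y c = evmx x c by [].
by rewrite subrr normr0 mulr0.
Qed.

End FibreTheorem.

(** * Algebraic dependence *)

Section AlgebraicDependence.
Variables (R : realType) (N : nat).
Local Notation mp := (mpoly N R).
Local Notation "''V'" := ('rV[R]_N).

Lemma msizeM_leq (p q : mp) (a b : nat) :
  (mmeasure mdeg p <= a.+1)%N -> (mmeasure mdeg q <= b.+1)%N ->
  (mmeasure mdeg (p * q) <= (a + b).+1)%N.
Proof.
move=> pa qb.
have [->|p0] := eqVneq p 0; first by rewrite mul0r mmeasure0.
have [->|q0] := eqVneq q 0; first by rewrite mulr0 mmeasure0.
rewrite msizeM //; move: (leq_add pa qb); rewrite addSn addnS.
by case: (_ + _)%N.
Qed.

Lemma msizeX_leq (p : mp) (a k : nat) :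
  (mmeasure mdeg p <= a.+1)%N -> (mmeasure mdeg (p ^+ k) <= (k * a).+1)%N.
Proof.
move=> pa; elim: k => [|k IHk]; first by rewrite expr0 mul0n msize1.
by rewrite exprS mulSn; exact: msizeM_leq.
Qed.

Lemma msize_prod_leq (I : finType) (F : I -> mp) (a : nat) :
  (forall i, (mmeasure mdeg (F i) <= a.+1)%N) ->
  (mmeasure mdeg (\prod_i F i) <= (#|I| * a).+1)%N.
Proof.
move=> Fa; rewrite -sum_nat_const.
rewrite (eq_bigl xpredT) //.
elim/big_ind2: _ => [|p a' q b' pa qb|i _]; first by rewrite msize1.
  exact: msizeM_leq.
exact: Fa.
Qed.

Lemma card_bmultinom_leq (B : nat) : (#|{: bmultinom N B}| <= B ^ N)%N.
Proof.
have bnd (m : bmultinom N B) i : (bmnm m i < B)%N.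
  apply: leq_ltn_trans (bmdeg m); rewrite mdegE (bigD1 i) //=; exact: leq_addr.
pose f (m : bmultinom N B) := [ffun i => Ordinal (bnd m i)].
have finj : injective f.
  move=> m1 m2 /ffunP f12; apply/val_inj/mnmP => i.
  by have := f12 i; rewrite !ffunE => /(congr1 val).
by have := leq_card f finj; rewrite card_ffun !card_ord.
Qed.

(** There are more polynomials than monomials in them. *)
Lemma exists_linear_relation (I : finType) (B : nat) (Q : I -> mp) :
  (forall i, (mmeasure mdeg (Q i) <= B)%N) -> (B ^ N < #|I|)%N ->
  exists2 u : I -> R, \sum_i u i *: Q i = 0 & exists i, u i != 0.
Proof.
move=> QB BI; pose J := bmultinom N B.
pose A : 'M[R]_(#|I|, #|{: J}|) :=
  \matrix_(i, j) mcoeff (bmnm (enum_val j)) (Q (enum_val i)).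
have : kermx A != 0.
  rewrite -mxrank_eq0 mxrank_ker -lt0n subn_gt0.
  apply: leq_ltn_trans (rank_leq_col A) _.
  exact: leq_ltn_trans (card_bmultinom_leq B) BI.
case/rowV0Pn => w /sub_kermxP wA w0.
exists (fun i => w 0 (enum_rank i)).
  apply/mpolyP => m; rewrite mcoeff0 raddf_sum /=.
  have [mB|mB] := ltnP (mdeg m) B; last first.
    apply: big1 => i _; rewrite mcoeffZ memN_msupp_eq0 ?mulr0 //.
    exact/msize_mdeg_ge/(leq_trans (QB i)).
  have /rowP/(_ (enum_rank (BMultinom mB : J))) := wA.
  rewrite !mxE (reindex (@enum_rank I)) => [wA0|].
    by rewrite -[RHS]wA0; apply: eq_bigr => i _; rewrite mcoeffZ mxE !enum_rankK.
  by exists enum_val => j _; rewrite ?enum_rankK ?enum_valK.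
have /rV0Pn[j wj] := w0.
by exists (enum_val j); rewrite enum_valK.
Qed.

(** The monomials of degree less than D in each of N + 1 given polynomials are
    D ^ N.+1 polynomials of degree O(D) in N variables, which span a space of
    dimension O(D ^ N): for large D they are linearly dependent. *)
Lemma algebraic_dependence (F : 'rV[mp]_N) (f : mp) :
  exists D, exists g : 'I_D -> mp, (exists k, g k != 0) /\
    forall x, \sum_k peval (evmx x F) (g k) * peval x f ^+ k = 0.
Proof.
pose d := (mmeasure mdeg f + \max_i mmeasure mdeg (F 0%R i))%N.
have fd : (mmeasure mdeg f <= d.+1)%N by rewrite leqW // leq_addr.
have Fd i : (mmeasure mdeg (F 0%R i) <= d.+1)%N.
  apply/leqW/(leq_trans _ (leq_addl _ _)).
  by apply: (@leq_bigmax _ (fun j => mmeasure mdeg (F 0%R j))).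
(* The products have degree less than D * e, and (D * e) ^ N < D ^ N.+1. *)
pose e := (d * N.+1).+1; pose D := (e ^ N).+1.
pose I := ({ffun 'I_N -> 'I_D} * 'I_D)%type.
pose Q (i : I) := (\prod_j F 0%R j ^+ i.1 j) * f ^+ i.2.
have QB i : (mmeasure mdeg (Q i) <= D * e)%N.
  have h1 : (mmeasure mdeg (\prod_j F 0%R j ^+ i.1 j) <= (N * (D * d)).+1)%N.
    have := @msize_prod_leq _ (fun j => F 0%R j ^+ i.1 j) (D * d).
    rewrite card_ord; apply=> j.
    apply: leq_trans (msizeX_leq _ (Fd j)) _.
    by rewrite ltnS leq_mul2r ltnW ?orbT.
  have h2 : (mmeasure mdeg (f ^+ i.2) <= (D * d).+1)%N.
    apply: leq_trans (msizeX_leq _ fd) _.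
    by rewrite ltnS leq_mul2r ltnW ?orbT.
  apply: leq_trans (msizeM_leq h1 h2) _.
  rewrite addnC -mulSn /e mulnS [(N.+1 * _)%N]mulnC -mulnA -addn1 addnC.
  by rewrite leq_add.
have [|u uQ [i0 ui0]] := exists_linear_relation QB.
  rewrite card_prod card_ffun !card_ord expnMn ltn_mul2l expn_gt0 /=.
  by rewrite /D ltnS.
pose X (a : {ffun 'I_N -> 'I_D}) := Multinom [tuple nat_of_ord (a i) | i < N].
exists D, (fun k => \sum_(a : {ffun 'I_N -> 'I_D}) u (a, k) *: mpolyX R (X a)).
split.
  exists i0.2; apply: contraNneq ui0 => /(congr1 (mcoeff (X i0.1))).
  rewrite mcoeff0 raddf_sum /= (bigD1 i0.1) //= mcoeffZ mcoeffX eqxx mulr1.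
  rewrite big1 ?addr0; first by case: i0 => ? ? /= ->.
  move=> a ai0; rewrite mcoeffZ mcoeffX.
  have -> : (X a == X i0.1) = false; last by rewrite mulr0.
  apply/negbTE; apply: contraNneq ai0 => /mnmP aX; apply/eqP/ffunP => i.
  by have := aX i; rewrite !multinomE !tnth_mktuple => /val_inj.
move=> x; have := congr1 (peval x) uQ; rewrite rmorph0 rmorph_sum /=.
rewrite (eq_bigr (fun p => peval x (u (p.1, p.2) *: Q (p.1, p.2)))); last by case.
rewrite -(pair_bigA _ (fun a k => peval x (u (a, k) *: Q (a, k)))) exchange_big /=.
move=> E0; rewrite -[RHS]E0; apply: eq_bigr => k _; rewrite rmorph_sum mulr_suml /=.
apply: eq_bigr => a _; rewrite !pevalZ -mulrA /Q rmorphM rmorphXn /=.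
congr (_ * (_ * _)); rewrite rmorph_prod {1}/peval mevalX /=.
by apply: eq_bigr => j _; rewrite rmorphXn /= multinomE tnth_mktuple !mxE.
Qed.

(** The image of F contains a ball, where the nonzero polynomial g k does not
    vanish identically. *)
Lemma algebraic_relation (F : 'rV[mp]_N) (f : mp) (x0 : 'V) : (0 < N)%N ->
  evmx x0 (jac F) = 1%:M ->
  exists D, exists g : 'I_D -> mp,
    (exists k x, peval (evmx x F) (g k) != 0) /\
    forall x, \sum_k peval (evmx x F) (g k) * peval x f ^+ k = 0.
Proof.
move=> N0 F1; have [D [g [[k gk] grel]]] := algebraic_dependence F f.
exists D, g; split=> //; exists k.
have [r r0 Fr] := jac_near_identity F1.
have r2 : 0 < r / 2 by rewrite divr_gt0.
have [y yr gy] := peval_neq0_ball N0 (evmx x0 F) gk r2.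
by have [x _ xy] := local_inverse r0 Fr yr; exists x; rewrite xy.
Qed.

End AlgebraicDependence.

(** * Generic rank and first-order behaviour *)

Section Generic.
Variables (R : realType) (N : nat).
Local Notation mp := (mpoly N R).
Local Notation "''V'" := ('rV[R]_N).

(** If L is a generalised inverse of the value G0 of G at a point of maximal rank,
    then h is the determinant of 1 - G0 *m L + G *m L, which is 1 at that point:
    where it does not vanish, G *m L has at least the rank of G0. *)
Lemma generic_max_rank n m (G : 'M[mp]_(n, m)) : exists2 h : mp, h != 0 &
  forall x, peval x h != 0 ->
    forall y, (\rank (evmx y G) <= \rank (evmx x G))%N.
Proof.
have bound k : `[< exists x, \rank (evmx x G) = k >] -> (k <= n)%N.
  by move=> /asboolP[x <-]; exact: rank_leq_row.
have ex : exists k, `[< exists x, \rank (evmx x G) = k >].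
  by exists (\rank (evmx 0 G)); apply/asboolP; exists 0.
case: (ex_maxnP ex bound) => r /asboolP[x0 rx0] rmax.
have [L PG0 LG0L] := exists_reflexive_inverse (evmx x0 G).
set P := evmx x0 G *m L in PG0.
pose E := constmx N (1%:M - P) + G *m constmx N L.
have evE x : evmx x E = 1%:M - P + evmx x G *m L.
  by rewrite evmxD evmxM !evmx_const.
have detE x : peval x (\det E) = \det (1%:M - P + evmx x G *m L).
  by rewrite -evE det_map_mx.
exists (\det E).
  apply/eqP => /(congr1 (peval x0)); rewrite detE rmorph0 subrK det1.
  by move/eqP; rewrite oner_eq0.
move=> x; rewrite detE => dE y.
apply: leq_trans (rmax _ (asboolT (ex_intro _ y erefl))) _.
have EP : (1%:M - P + evmx x G *m L) *m P = evmx x G *m L.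
  rewrite mulmxDl mulmxBl mul1mx {2}/P [P *m _]mulmxA PG0 subrr add0r -mulmxA.
  by rewrite [L *m P]mulmxA LG0L.
rewrite -rx0 -[X in \rank X]PG0; apply: leq_trans (mxrankM_maxl _ _) _.
apply: leq_trans (mxrankM_maxl (evmx x G) L); rewrite -EP [X in (_ <= X)%N]eqmxMfull //.
by rewrite row_full_unit unitmxE unitfE.
Qed.

(** u is stationary at 0.  For polynomial u this is the vanishing of the
    derivative, but it passes through linear changes of variables without
    any chain rule. *)
Definition flat m (u : R -> 'rV[R]_m) : Prop :=
  exists C, forall t, `|t| <= 1 -> `|u t - u 0| <= C * t ^+ 2.

Lemma flat_linear m (w : 'rV[R]_m) : flat (fun t => t *: w) -> w = 0.
Proof.
case=> C uC; apply/eqP/negPn/negP => w0.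
have nw : 0 < `|w| by rewrite normr_gt0.
pose D := Num.max C 1; have D0 : 0 < D by rewrite lt_max ltr01 orbT.
pose t := Num.min 1 (`|w| / D / 2).
have t0 : 0 < t by rewrite lt_min ltr01 !divr_gt0.
have t1 : `|t| <= 1 by rewrite (ger0_norm (ltW t0)) /t ge_min lexx.
have := uC t t1; rewrite scale0r subr0 normrZ (ger0_norm (ltW t0)).
rewrite expr2 mulrCA ler_pM2l // => wC.
have : `|w| <= D * (`|w| / D / 2).
  apply: le_trans wC _; apply: (@le_trans _ _ (D * t)).
    by rewrite (ler_wpM2r (ltW t0)) // /D le_max lexx.
  by rewrite ler_pM2l // /t ge_min lexx orbT.
rewrite mulrA mulrCA divff ?gt_eqF // mulr1 ler_pdivlMr // leNgt ltr_pMr //.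
by rewrite ltr1n.
Qed.

Lemma jac_flat m (c : 'rV[mp]_m) (x v : 'V) :
  v *m evmx x (jac c) = 0 <-> flat (fun t => evmx (x + t *: v) c).
Proof.
have [C C0 HC] := evmx_taylor c (`|x| + `|v|).
have xK : `|x| <= `|x| + `|v| by rewrite lerDl.
have taylor t : `|t| <= 1 -> `|evmx (x + t *: v) c - evmx x c -
    t *: (v *m evmx x (jac c))| <= C * `|v| ^+ 2 * t ^+ 2.
  move=> t1; have := HC x (x + t *: v) xK _.
  have -> : x + t *: v - x = t *: v by rewrite addrAC subrr add0r.
  rewrite -scalemxAl normrZ exprMn -normrX [`|t ^+ 2|]ger0_norm ?sqr_ge0 //.
  rewrite [_ * `|v| ^+ 2]mulrC mulrA; apply.
  apply: le_trans (ler_normD _ _) _; rewrite lerD2l normrZ.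
  by rewrite ler_piMl.
split=> [vJ|[D uD]].
  exists (C * `|v| ^+ 2) => t t1; have := taylor t t1.
  by rewrite vJ scaler0 subr0 scale0r addr0.
apply: flat_linear; exists (C * `|v| ^+ 2 + D) => t t1.
have := uD t t1; rewrite scale0r addr0 => h.
have h' := taylor t t1; rewrite scale0r subr0.
rewrite -[t *: _](subKr (evmx (x + t *: v) c - evmx x c)).
by apply: le_trans (ler_normB _ _) _; rewrite mulrDl addrC lerD.
Qed.

End Generic.

Lemma peval_comp (R : realType) N N' (T : 'rV[mpoly N R]_N') (q : mpoly N' R) :
  exists q' : mpoly N R, forall x, peval x q' = peval (evmx x T) q.
Proof.
exists (comp_mpoly [tuple T 0 i | i < N'] q) => x.
by rewrite /peval comp_mpoly_meval; apply: meval_eq => i; rewrite tnth_mktuple mxE.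
Qed.

Lemma finite_roots (R : realType) (p : {poly R}) :
  p != 0 -> finite_set [set z | p.[z] = 0].
Proof.
move=> p0; apply: contrapT => /infiniteP/ppcard_leP[f].
pose s := [seq f i | i <- iota 0 (size p)].
have : (size s < size p)%N.
  apply: max_poly_roots => //.
    by apply/allP => _ /mapP[i _ ->]; apply/eqP; exact: (@funS _ _ _ _ f i).
  by rewrite map_inj_uniq ?iota_uniq // => i j; apply: (@inj _ _ _ f); rewrite inE.
by rewrite size_map size_iota ltnn.
Qed.

(** * Walks, cycles and potentials *)

Section Walks.
Variables (R : realType) (n : nat) (e : rel 'I_n) (w : 'I_n -> 'I_n -> R).

Fixpoint walk_weight (x : 'I_n) (s : seq 'I_n) : R :=
  if s is y :: s' then w x y + walk_weight y s' else 0.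

Lemma walk_weight_cat x s1 s2 :
  walk_weight x (s1 ++ s2) = walk_weight x s1 + walk_weight (last x s1) s2.
Proof. by elim: s1 x => [|y s1 IH] x /=; rewrite ?add0r // IH addrA. Qed.

Lemma walk_weightE x s : walk_weight x s = \sum_(xy <- zip (x :: s) s) w xy.1 xy.2.
Proof.
by elim: s x => [|y s IH] x /=; rewrite ?big_nil // big_cons IH.
Qed.

Lemma nonuniq_split (T : eqType) (s : seq T) : ~~ uniq s ->
  exists a y b c, s = a ++ y :: b ++ y :: c.
Proof.
elim: s => //= y s IH; rewrite negb_and negbK => /orP[ys|/IH[a [z [b [c ->]]]]].
  by case/splitPr: ys => b c; exists [::], y, b, c.
by exists (y :: a), z, b, c.
Qed.

(** A repeated vertex cuts off a closed walk. *)
Lemma walk_excise x s : path e x s -> ~~ uniq s ->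
  exists s' y b, [/\ path e x s' /\ last x s' = last x s, path e y b /\ last y b = y,
    walk_weight x s = walk_weight x s' + walk_weight y b,
    (size s' < size s)%N & (size b < size s)%N].
Proof.
move=> + /nonuniq_split[a [y [b [c sE]]]]; rewrite {}sE.
rewrite cat_path /= cat_path /= => /and5P[xa ay yb bY yc].
exists (a ++ y :: c), y, (rcons b y); split.
- by rewrite cat_path /= xa ay yc !last_cat /= last_cat.
- by rewrite rcons_path yb bY last_rcons.
- rewrite !walk_weight_cat /= walk_weight_cat /= -cats1 walk_weight_cat /=.
  by ring.
- by rewrite !size_cat /= size_cat /=; lia.
- by rewrite size_rcons !size_cat /= size_cat /=; lia.
Qed.

Hypothesis cycle0 : forall x s, cycle e (x :: s) -> uniq (x :: s) ->
  walk_weight x (rcons s x) = 0.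

(** By induction on the length: a closed walk is a cycle, or closed walks are cut
    off from it. *)
Lemma closed_walk_weight x s : path e x s -> last x s = x -> walk_weight x s = 0.
Proof.
have [k] := ubnP (size s); elim: k s x => // k IH s x; rewrite ltnS => sk xs sx.
have [us|] := boolP (uniq s); last first.
  case/(walk_excise xs)=> s' [y [b [[xs' s'x] [yb by'] -> lts' ltb]]].
  rewrite (IH s') ?(IH b) ?addr0 //; try exact: leq_trans sk.
  by rewrite s'x.
case: (lastP s) us xs sx => // s' z us xs; rewrite last_rcons => zx.
rewrite zx in us xs *; apply: cycle0; first by [].
by move: us; rewrite rcons_uniq.
Qed.

(** Likewise, a walk is a path up to closed walks. *)
Lemma io_walk_weight (I O : {pred 'I_n}) :
  (forall x s, x \in I -> last x s \in O -> path e x s -> uniq (x :: s) ->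
    walk_weight x s = 0) ->
  forall x s, x \in I -> last x s \in O -> path e x s -> walk_weight x s = 0.
Proof.
move=> io0 x s; have [k] := ubnP (size s); elim: k s => // k IH s.
rewrite ltnS => sk xI sO xs.
have [xus|] := boolP (uniq (x :: s)); first exact: io0.
rewrite /= negb_and negbK => /orP[xins|/(walk_excise xs)].
  case/splitPr: xins sk xs sO => a c; rewrite size_cat /= => sk.
  rewrite cat_path /= => /and3P[xa ax xc]; rewrite last_cat /= => cO.
  rewrite -cat_rcons walk_weight_cat last_rcons closed_walk_weight ?last_rcons //.
    rewrite add0r IH //; apply: leq_trans sk; rewrite addnS ltnS; exact: leq_addl.
  by rewrite rcons_path xa.
case=> [s' [y [b [[xs' s'x] [yb by'] -> lts' ltb]]]].
rewrite (closed_walk_weight yb by') addr0 IH //; first exact: leq_trans sk.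
by rewrite s'x.
Qed.

End Walks.

Section ModelGraph.
Variables (n : nat) (M : lcmodel n).
Local Notation e := (graph M).

Definition single_io_connected : Prop :=
  (strongly_io_connected M /\ #|outputs M| = 1%N) \/
  (strongly_connected M /\ #|inputs M| = 1%N).

Lemma cycle_edges_path (x : 'I_n) s : cycle_edges (x :: s) = path_edges x (rcons s x).
Proof.
rewrite /cycle_edges /path_edges rot1_cons -rcons_cons -[rcons (x :: s) x]cats1.
by rewrite -[X in _ = zip _ X]cats0 zip_cat ?size_rcons //= cats0.
Qed.

Lemma path_edges_all (e : rel 'I_n) (x : 'I_n) s : path e x s ->
  all (fun uv => e uv.1 uv.2) (path_edges x s).
Proof.
rewrite /path_edges; elim: s x => //= y s IH x /andP[xy ys].
by rewrite xy IH.
Qed.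

Lemma path_edge_connect z s x y : path e z s -> (x, y) \in path_edges z s ->
  connect e z x /\ connect e y (last z s).
Proof.
rewrite /path_edges; elim: s z => //= v s IH z /andP[zv vs].
rewrite inE => /predU1P[[-> ->]|xy].
  by split=> //; apply/connectP; exists s.
have [vx yl] := IH v vs xy; split=> //.
exact: connect_trans (connect1 zv) vx.
Qed.

Lemma cycle_edge_connect s x y : is_cycle M s -> (x, y) \in cycle_edges s ->
  connect e y x.
Proof.
case=> _ /andP[cs _] xy; apply: (connect_cycle cs).
  have := map_f snd xy; rewrite -/(unzip2 _) unzip2_zip ?size_rot //.
  by rewrite mem_rot.
by have := map_f fst xy; rewrite -/(unzip1 _) unzip1_zip ?size_rot.
Qed.

Lemma weakly_connected_closed (P : {pred 'I_n}) : weakly_connected M ->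
  (forall x y, e x y -> (x \in P) = (y \in P)) ->
  forall x y, (x \in P) = (y \in P).
Proof.
move=> wc Pe x y; apply: closed_connect (wc x y) => u v /orP[/Pe//|/Pe].
by move->.
Qed.

(** The set of the vertices that an input reaches, and that of the vertices that
    reach the output, are unions of connected components: an edge with one end in
    the set lies in a cycle or in a path from an input to the output, so its
    other end is in the set as well. *)
Lemma io_reachable : single_io_connected -> forall x,
  (exists2 i, i \in inputs M & connect e i x) /\
  (exists2 o, o \in outputs M & connect e x o).
Proof.
have [i0 i0I] : exists i, i \in inputs M by apply/set0Pn/inputs_neq0.
have [j0 j0O] : exists o, o \in outputs M by apply/set0Pn/outputs_neq0.
case=> [[[wc se] O1]|[sc I1]] x; last by split; [exists i0 | exists j0].
have outE o : o \in outputs M -> o = j0.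
  by move/eqP/cards1P: O1 => [a Oa]; move: j0O; rewrite Oa !inE => /eqP-> /eqP.
split.
  pose P := [pred x | [exists i in inputs M, connect e i x]].
  have Pe u v : e u v -> (u \in P) = (v \in P).
    move=> uv; apply/exists_inP/exists_inP => -[i iI ic].
      by exists i => //; exact: connect_trans (connect1 uv).
    case: (se u v uv) => [[s cs uvs]|[z [s [[zI _ zs _] uvs]]]].
      by exists i => //; exact: connect_trans (cycle_edge_connect cs uvs).
    by exists z => //; have [] := path_edge_connect zs uvs.
  have : x \in P.
    rewrite (weakly_connected_closed wc Pe x i0).
    by apply/exists_inP; exists i0.
  by case/exists_inP => i; exists i.
exists j0 => //.
pose P := [pred x | connect e x j0].
have Pe u v : e u v -> (u \in P) = (v \in P).
  move=> uv; rewrite !inE; apply/idP/idP => uo; last first.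
    exact: connect_trans (connect1 uv) uo.
  case: (se u v uv) => [[s cs uvs]|[z [s [[_ zO zs _] uvs]]]].
    exact: connect_trans (cycle_edge_connect cs uvs) uo.
  by have [_] := path_edge_connect zs uvs; rewrite (outE _ zO).
have : x \in P by rewrite (weakly_connected_closed wc Pe x j0) inE.
by [].
Qed.

(** In a strongly connected graph, an edge is closed up to a cycle by a path from
    its end to its origin. *)
Lemma edge_in_cycle_or_path : single_io_connected -> forall x y, e x y ->
  (exists2 s, is_cycle M s & (x, y) \in cycle_edges s) \/
  (exists z s, is_io_path M z s /\ (x, y) \in path_edges z s).
Proof.
case=> [[[_ se] _]|[sc _]] x y xy; first exact: se.
left; case/connectP: (sc y x) => p0 /shortenP[p yp uyp _] xE.
exists (y :: p).
  by split=> //; apply/andP; split=> //=; rewrite rcons_path yp -xE.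
rewrite /cycle_edges rot1_cons lastI zip_rcons ?size_belast // -xE.
by rewrite mem_rcons inE eqxx.
Qed.

(** If there is one input i, the potential of x is the weight of a walk from i to
    x.  It does not depend on the walk, as any walk from x to an output completes
    it to a walk of weight 0.  If there is one output o, walks from x to o are
    used, completed by a walk from an input to x. *)
Theorem exists_potential (R : realType) (w : 'I_n -> 'I_n -> R) :
  single_io_connected ->
  (forall s, is_cycle M s -> \sum_(xy <- cycle_edges s) w xy.1 xy.2 = 0) ->
  (forall z s, is_io_path M z s ->
    \sum_(xy <- path_edges z s) w xy.1 xy.2 = 0) ->
  exists phi : 'I_n -> R, (forall x y, e x y -> w x y = phi y - phi x) /\
    forall x, x \in inputs M :|: outputs M -> phi x = 0.
Proof.
move=> conn w_cycle w_path.
have cycle0 x s : cycle e (x :: s) -> uniq (x :: s) ->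
    walk_weight w x (rcons s x) = 0.
  move=> cs us; rewrite walk_weightE -[zip _ _]/(path_edges x (rcons s x)).
  by rewrite -cycle_edges_path; apply: w_cycle; split=> //; apply/andP.
have io0 : forall x s, x \in inputs M -> last x s \in outputs M ->
    path e x s -> walk_weight w x s = 0.
  apply: (io_walk_weight cycle0) => x s xI sO xs us.
  by rewrite walk_weightE; apply: w_path.
have reach := io_reachable conn.
have [fwd|bwd] : (exists2 i, i \in inputs M & forall x, connect e i x /\
      (x \in inputs M -> x = i)) \/
    (exists2 o, o \in outputs M & forall x, connect e x o /\
      (x \in outputs M -> x = o)).
- case: (conn) => [[_ /eqP/cards1P[t tO]]|[_ /eqP/cards1P[t tI]]]; [right|left].
    exists t => [|x]; first by rewrite tO inE.
    have [_ [u uO xu]] := reach x; split; last by rewrite tO inE => /eqP.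
    by move: uO; rewrite tO inE => /eqP <-.
  exists t => [|x]; first by rewrite tI inE.
  have [[u uI ux] _] := reach x; split; last by rewrite tI inE => /eqP.
  by move: uI; rewrite tI inE => /eqP <-.
- case: fwd => i iI ix.
  have [p pP] : {p : 'I_n -> seq 'I_n & forall x, path e i (p x) /\ last i (p x) = x}.
    apply: (@choice _ _ (fun x s => path e i s /\ last i s = x)) => x.
    by have [/connectP[s is_ ->] _] := ix x; exists s.
  pose phi x := walk_weight w i (p x).
  have phiE x s : path e i s -> last i s = x -> walk_weight w i s = phi x.
    move=> ps sx; have [_ [u uO /connectP[q xq uE]]] := reach x.
    have [pp px] := pP x.
    have h1 : walk_weight w i (s ++ q) = 0.
      by apply: io0; rewrite ?last_cat ?cat_path ?sx -?uE // ps.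
    have h2 : walk_weight w i (p x ++ q) = 0.
      by apply: io0; rewrite ?last_cat ?cat_path ?px -?uE // pp.
    move: h1 h2; rewrite !walk_weight_cat sx px -/(phi x) => h1 h2.
    by apply: (addIr (walk_weight w x q)); rewrite h1 h2.
  exists phi; split=> [x y xy|x].
    have [pp px] := pP x.
    have := phiE y (rcons (p x) y); rewrite rcons_path last_rcons pp px xy.
    move=> /(_ isT erefl) <-; rewrite -cats1 walk_weight_cat px /= addr0.
    by rewrite -/(phi x) addrC addKr.
  rewrite inE => /orP[xI|xO].
    by have [_ /(_ xI) ->] := ix x; rewrite -(phiE i [::]).
  by have [pp px] := pP x; apply: io0 => //; rewrite px.
- case: bwd => o oO xo.
  have [p pP] : {p : 'I_n -> seq 'I_n & forall x, path e x (p x) /\ last x (p x) = o}.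
    apply: (@choice _ _ (fun x s => path e x s /\ last x s = o)) => x.
    by have [/connectP[s is_ ->] _] := xo x; exists s.
  pose phi x := - walk_weight w x (p x).
  have phiE x s : path e x s -> last x s = o -> walk_weight w x s = - phi x.
    move=> ps sx; have [[u uI /connectP[q uq xE]] _] := reach x.
    have [pp px] := pP x.
    have h1 : walk_weight w u (q ++ s) = 0.
      by apply: io0; rewrite ?last_cat ?cat_path -?xE ?sx // uq.
    have h2 : walk_weight w u (q ++ p x) = 0.
      by apply: io0; rewrite ?last_cat ?cat_path -?xE ?px // uq.
    move: h1 h2; rewrite !walk_weight_cat -xE => h1 h2; rewrite /phi opprK.
    by apply: (addrI (walk_weight w u q)); rewrite h1 h2.
  exists phi; split=> [x y xy|x].
    have [pp px] := pP y.
    have := phiE x (y :: p y); rewrite /= xy pp px.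
    by move=> /(_ isT erefl) => h; rewrite -[phi x]opprK -h /phi; ring.
  rewrite inE => /orP[xI|xO].
    have [pp px] := pP x; apply/eqP; rewrite oppr_eq0; apply/eqP.
    by apply: io0 => //; rewrite px.
  have [_ /(_ xO) ->] := xo x; apply: oppr_inj.
  by rewrite -(phiE o [::]) //= oppr0.
Qed.

End ModelGraph.

(** * The coefficients as polynomials in the parameters *)

Section CoefficientPolynomials.
Variables (R : realType) (n : nat) (M : lcmodel n).
Local Notation P := #|{: param M}|.
Local Notation mp := (mpoly P R).
Local Notation coef_index := ('I_n * 'I_n.+1 + 'I_n * 'I_n * 'I_n.+1)%type.

Definition var_mpoly (t : param M) : mp := mpolyX R (mnm1 (enum_rank t)).

Lemma peval_var x t : peval x (var_mpoly t) = pval x t.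
Proof. exact: pevalX. Qed.

Definition mon_mpoly (m : seq (param M)) : mp := \prod_(t <- m) var_mpoly t.

Lemma peval_mon x m : peval x (mon_mpoly m) = monomial_val m x.
Proof. by rewrite rmorph_prod; apply: eq_bigr => t _; exact: peval_var. Qed.

Definition edge_mpoly (i j : 'I_n) : mp :=
  if insub (j, i) is Some e then var_mpoly (inl e) else 0.

Definition leak_mpoly (i : 'I_n) : mp :=
  if insub i is Some l then var_mpoly (inr l) else 0.

Definition comp_mx_mpoly : 'M[mp]_n :=
  \matrix_(i, j)
    if i == j then
      if leaks M == [set: 'I_n]%SET then leak_mpoly i
      else - leak_mpoly i - \sum_(k | graph M i k) edge_mpoly k i
    else edge_mpoly i j.

Lemma evmx_comp_mx x : evmx x comp_mx_mpoly = comp_mx x.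
Proof.
have edgeE i j : peval x (edge_mpoly i j) = edge_val x i j.
  by rewrite /edge_mpoly /edge_val; case: insub => [u|]; rewrite ?rmorph0 ?peval_var.
have leakE i : peval x (leak_mpoly i) = leak_val x i.
  by rewrite /leak_mpoly /leak_val; case: insub => [u|]; rewrite ?rmorph0 ?peval_var.
apply/matrixP => i j; rewrite !mxE; case: eqP => // _; case: eqP => // _.
rewrite rmorphB rmorphN rmorph_sum /= leakE; congr (_ - _).
by apply: eq_bigr => k _; exact: edgeE.
Qed.

Definition coef_mpoly (k : coef_index) : mp :=
  match k with
  | inl (j, d) => (char_poly comp_mx_mpoly)`_d
  | inr (i, j, d) => (cofactor (char_poly_mx comp_mx_mpoly) i j)`_d
  end.

Lemma peval_coef x k : peval x (coef_mpoly k) = coef k x.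
Proof.
case: k => [[j d]|[[i j] d]] /=; rewrite -coef_map.
  by rewrite map_char_poly -/(evmx x comp_mx_mpoly) evmx_comp_mx.
rewrite -cofactor_map_mx map_char_poly_mx -/(evmx x comp_mx_mpoly).
by rewrite evmx_comp_mx.
Qed.

(** Absent coefficients are set to 0, so that the rows of M and of its full-leak
    model have the same index set. *)
Definition coef_row : 'rV[mp]_#|{: coef_index}| :=
  \row_i if coef_present M (enum_val i) then coef_mpoly (enum_val i) else 0.

Lemma coef_row_eq p q : evmx p coef_row = evmx q coef_row <->
  forall k, coef_present M k -> coef k p = coef k q.
Proof.
split=> [/rowP pq k kM|pq].
  by have := pq (enum_rank k); rewrite !mxE enum_rankK kM !peval_coef.
apply/rowP => i; rewrite !mxE; case: ifP => [/pq|_]; last by rewrite !rmorph0.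
by rewrite !peval_coef.
Qed.

(** The present coefficients that are not kept are constant. *)
Lemma io_coef_map_eq (p q : 'rV[R]_P) : io_coef_map p = io_coef_map q <->
  evmx p coef_row = evmx q coef_row.
Proof.
rewrite coef_row_eq; split=> [/ffunP pq k kM|pq].
  have [kk|] := boolP (coef_kept R M k).
    by have := pq (Sub k kk); rewrite !ffunE.
  rewrite /coef_kept kM /= => /asboolPn/not_andP[] /contrapT ->; by [].
by apply/ffunP => k; rewrite !ffunE; apply: pq; case/andP: (valP k).
Qed.

End CoefficientPolynomials.

(** * Conjugation by diagonal matrices *)

Section DiagonalScaling.
Variable T : comNzRingType.

Definition scale_mx m n (a : 'I_m -> T) (b : 'I_n -> T) (A : 'M[T]_(m, n)) :=
  \matrix_(i, j) (a i * A i j * b j).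

Lemma det_scale_mx m (a b : 'I_m -> T) (A : 'M[T]_m) :
  \det (scale_mx a b A) = (\prod_i a i) * \det A * (\prod_i b i).
Proof.
have -> : scale_mx a b A = diag_mx (\row_i a i) *m A *m diag_mx (\row_i b i).
  by apply/matrixP => i j; rewrite mul_mx_diag mul_diag_mx !mxE.
rewrite !det_mulmx !det_diag; congr (_ * _ * _); by apply: eq_bigr => i _; rewrite mxE.
Qed.

Lemma prod_lift m (i : 'I_m) (F : 'I_m -> T) :
  F i * \prod_k F (lift i k) = \prod_k F k.
Proof. by rewrite [RHS](bigD1_ord i). Qed.

(** The scaling of a minor differs from that of the whole determinant by the
    factors of the deleted row and column, which are 1. *)
Lemma cofactor_scale_mx m (a b : 'I_m -> T) (A : 'M[T]_m) i j :
  (forall k, a k * b k = 1) -> a i = 1 -> b j = 1 ->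
  cofactor (scale_mx a b A) i j = cofactor A i j.
Proof.
move=> ab ai bj; rewrite /cofactor; congr (_ * _).
have -> : row' i (col' j (scale_mx a b A)) =
    scale_mx (a \o lift i) (b \o lift j) (row' i (col' j A)).
  by apply/matrixP => k l; rewrite !mxE.
have := prod_lift i a; have := prod_lift j b.
rewrite ai bj !mul1r det_scale_mx => -> ->.
rewrite mulrAC -big_split /= big1 ?mul1r //.
Qed.

End DiagonalScaling.

(** * Monomials of walks and columns of the compartmental matrix *)

Section PathMonomials.
Variables (R : realType) (n : nat) (M : lcmodel n).
Local Notation P := #|{: param M}|.

(** A self-cycle is treated apart; the edges of a cycle are those of a closed
    walk.  So a statement on all monomials reduces to one on walks that are closed
    or join an input to an output. *)
Lemma path_cycle_monomial_walk (Q : seq (param M) -> Prop) :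
  (forall i, Q [:: inr i]) ->
  (forall x s, path (graph M) x s ->
    last x s = x \/ (x \in inputs M /\ last x s \in outputs M) ->
    Q (edge_monomial M (path_edges x s))) ->
  forall m, path_cycle_monomial m -> Q m.
Proof.
move=> Qi Qp m [[[|x s] [s0 /andP[cs us]] ->]|[i ->]|[x [s [[xI sO xs us] ->]]]] //.
  by rewrite cycle_edges_path; apply: Qp => //; left; rewrite last_rcons.
by apply: Qp => //; right.
Qed.

Lemma monomial_val_edges (es : seq ('I_n * 'I_n)) (p : 'rV[R]_P) :
  all (fun uv => graph M uv.1 uv.2) es ->
  monomial_val (edge_monomial M es) p = \prod_(uv <- es) edge_val p uv.2 uv.1.
Proof.
rewrite /monomial_val /edge_monomial; elim: es => [|[u v] es IH] /=.
  by rewrite !big_nil.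
case/andP=> uv /IH {}IH; rewrite big_cons /= /edge_val insubT /= big_cons IH.
by [].
Qed.

Lemma comp_mx_off (p : 'rV[R]_P) i j : i != j -> comp_mx p i j = edge_val p i j.
Proof. by move=> /negbTE ij; rewrite mxE ij. Qed.

Lemma edge_val_notin (p : 'rV[R]_P) i j : ~~ graph M j i -> edge_val p i j = 0.
Proof. by move=> /negbTE ij; rewrite /edge_val insubF. Qed.

Lemma graph_neq i j : graph M i j -> i != j.
Proof. by apply: contraTneq => ->; rewrite graph_irreflexive. Qed.

Lemma comp_mx_edge (p : 'rV[R]_P) i j : graph M j i ->
  comp_mx p i j = edge_val p i j.
Proof. by move=> /graph_neq ij; rewrite comp_mx_off // eq_sym. Qed.

Lemma weighted_col_sum (p : 'rV[R]_P) (phi : 'I_n -> R) i :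
  \sum_k phi k * comp_mx p k i =
  phi i * comp_mx p i i + \sum_(k | graph M i k) phi k * edge_val p k i.
Proof.
rewrite (bigD1 i) //=; congr (_ + _).
rewrite (bigID (graph M i)) /= [X in _ + X]big1 ?addr0.
  apply: eq_big => [k|k /andP[ki ik]]; last by rewrite comp_mx_off.
  have [ik|] := boolP (graph M i k); last by rewrite andbF.
  by rewrite andbT eq_sym graph_neq.
by move=> k /andP[ki ik]; rewrite comp_mx_off // edge_val_notin ?mulr0.
Qed.

Lemma col_sum (p : 'rV[R]_P) i : \sum_k comp_mx p k i =
  comp_mx p i i + \sum_(k | graph M i k) edge_val p k i.
Proof.
have := weighted_col_sum p (fun=> 1) i; rewrite mul1r.
by congr (_ = _ + _); apply: eq_bigr => k _; rewrite mul1r.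
Qed.

End PathMonomials.

(** * The full-leak model *)

Section FullLeak.
Variables (R : realType) (n : nat) (M : lcmodel n).
Local Notation Mt := (full_leak M).
Local Notation P := #|{: param M}|.
Local Notation Pt := #|{: param Mt}|.
Local Notation L := (inputs M :|: outputs M).

Lemma in_full_leaks (i : 'I_n) : i \in leaks Mt. Proof. exact: finset.in_setT. Qed.

Definition full_leak_param (i : 'I_n) : param Mt := inr (exist _ i (in_full_leaks i)).

Lemma comp_mx_full_diag (x : 'rV[R]_Pt) i :
  comp_mx x i i = pval x (full_leak_param i).
Proof.
rewrite mxE !eqxx /leak_val insubT ?in_full_leaks // => h.
by congr (pval x (inr _)); apply: val_inj.
Qed.

Definition full_leak_vector T (f : edge_type M -> T) (a : 'I_n -> T) : 'rV[T]_Pt :=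
  \row_t match enum_val t with inl u => f u | inr i => a (val i) end.

Lemma full_leak_vector_edge T (f : edge_type M -> T) a u :
  full_leak_vector f a 0 (enum_rank (inl u : param Mt)) = f u.
Proof. by rewrite mxE enum_rankK. Qed.

Lemma full_leak_vector_diag T (f : edge_type M -> T) a i :
  full_leak_vector f a 0 (enum_rank (full_leak_param i)) = a i.
Proof. by rewrite mxE enum_rankK. Qed.

Lemma full_leak_ext (x y : 'rV[R]_Pt) :
  (forall u, pval x (inl u) = pval y (inl u)) ->
  (forall i, pval x (full_leak_param i) = pval y (full_leak_param i)) -> x = y.
Proof.
move=> xyE xyD; apply/rowP => t; rewrite -(enum_valK t).
case: (enum_val t) => [u|[i iP]]; first exact: xyE.
by rewrite (bool_irrelevance iP (in_full_leaks i)); exact: xyD.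
Qed.

Lemma edge_val_edge (N : lcmodel n) (x : 'rV[R]_#|{: param N}|) (u : edge_type N) :
  edge_val x (val u).2 (val u).1 = pval x (inl u).
Proof.
rewrite /edge_val -surjective_pairing insubT; first exact: (valP u).
by move=> h; congr (pval x (inl _)); apply: val_inj.
Qed.

Lemma edge_val_full (x : 'rV[R]_P) (y : 'rV[R]_Pt) (u : 'I_n -> 'I_n -> R) :
  (forall e : edge_type M, pval y (inl e) = u (val e).2 (val e).1 * pval x (inl e)) ->
  forall i j, edge_val y i j = u i j * edge_val x i j.
Proof.
move=> yx i j; have [ji|ji] := boolP (graph M j i); last first.
  by rewrite !edge_val_notin ?mulr0.
by have := yx (exist _ (j, i) ji); rewrite -!edge_val_edge.
Qed.

(** Through [embed_mpoly] the polynomials on the full-leak model restrict to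
    polynomials on M. *)
Definition embed_mpoly : 'rV[mpoly P R]_Pt :=
  full_leak_vector (fun u => var_mpoly R (inl u : param M))
    (fun i => comp_mx_mpoly R M i i).

Definition embed (p : 'rV[R]_P) : 'rV[R]_Pt := evmx p embed_mpoly.

Lemma embed_edge p u : pval (embed p) (inl u) = pval p (inl u).
Proof. by rewrite /pval /embed mxE full_leak_vector_edge peval_var. Qed.

Lemma embed_diag p i : pval (embed p) (full_leak_param i) = comp_mx p i i.
Proof. by rewrite /pval /embed mxE full_leak_vector_diag -evmx_comp_mx [RHS]mxE. Qed.

Lemma comp_mx_embed p : comp_mx (embed p) = comp_mx p.
Proof.
apply/matrixP => i j; have [<-|ij] := eqVneq i j.
  by rewrite comp_mx_full_diag embed_diag.
rewrite !comp_mx_off // (@edge_val_full p _ (fun _ _ => 1)) ?mul1r // => u.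
by rewrite mul1r embed_edge.
Qed.

Lemma comp_mx_linear (N : lcmodel n) (x v : 'rV[R]_#|{: param N}|) (t : R) :
  comp_mx (x + t *: v) = comp_mx x + t *: comp_mx v.
Proof.
have edgeD i j : edge_val (x + t *: v) i j = edge_val x i j + t * edge_val v i j.
  by rewrite /edge_val; case: insub => [u|]; rewrite /pval ?mxE ?mulr0 ?addr0.
have leakD i : leak_val (x + t *: v) i = leak_val x i + t * leak_val v i.
  by rewrite /leak_val; case: insub => [u|]; rewrite /pval ?mxE ?mulr0 ?addr0.
apply/matrixP => i j; rewrite !mxE; case: eqP => // _; case: eqP => // _.
rewrite leakD (eq_bigr (fun k => edge_val x k i + t * edge_val v k i)) => [|k _] //.
by rewrite big_split /= -mulr_sumr; ring.
Qed.

Lemma embed_linear (x v : 'rV[R]_P) (t : R) :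
  embed (x + t *: v) = embed x + t *: embed v.
Proof.
have E (y z : 'rV[R]_Pt) s : pval (y + t *: z) s = pval y s + t * pval z s.
  by rewrite /pval !mxE.
apply: full_leak_ext => [u|i]; rewrite E.
  by rewrite !embed_edge /pval !mxE.
by rewrite !embed_diag comp_mx_linear !mxE.
Qed.

Lemma coef_row_full_eq (x : 'rV[R]_Pt) (p : 'rV[R]_P) :
  comp_mx x = comp_mx p -> evmx x (coef_row R Mt) = evmx p (coef_row R M).
Proof.
move=> xp; apply/rowP => i; rewrite !mxE.
have -> : coef_present Mt (enum_val i) = coef_present M (enum_val i).
  by case: (enum_val i) => [[j d]|[[k j] d]].
case: ifP => _; last by rewrite !rmorph0.
by rewrite !peval_coef; case: (enum_val i) => [[j d]|[[k j] d]] /=; rewrite xp.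
Qed.

(** In terms of the compartmental matrix, conjugation by the diagonal matrix of
    entries d: see [comp_mx_act]. *)
Definition act (d : 'I_n -> R) (x : 'rV[R]_Pt) : 'rV[R]_Pt :=
  full_leak_vector
    (fun u => d (val u).2 * pval x (inl u : param Mt) / d (val u).1)
    (fun i => pval x (full_leak_param i)).

Lemma edge_val_act d x i j : edge_val (act d x) i j = d i * edge_val x i j / d j.
Proof.
have [ji|ji] := boolP (graph Mt j i); last by rewrite !edge_val_notin ?mulr0 ?mul0r.
have := full_leak_vector_edge (fun u =>
  d (val u).2 * pval x (inl u : param Mt) / d (val u).1)
  (fun i => pval x (full_leak_param i)) (exist _ (j, i) ji).
rewrite -[LHS]/(pval (act d x) (inl (exist _ (j, i) ji : edge_type Mt))).
by rewrite -!edge_val_edge.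
Qed.

Lemma act_diag d x i : pval (act d x) (full_leak_param i) = pval x (full_leak_param i).
Proof. exact: full_leak_vector_diag. Qed.

Lemma act_linear d x v (t : R) : act d (x + t *: v) = act d x + t *: act d v.
Proof.
apply/rowP => s; rewrite !mxE; case: (enum_val s) => [u|i]; rewrite /pval !mxE //.
by rewrite mulrDr mulrDl [t * v _ _]mulrC !mulrA; ring.
Qed.

Lemma comp_mx_act d x : (forall i, d i != 0) ->
  comp_mx (act d x) = scale_mx d (fun j => (d j)^-1) (comp_mx x).
Proof.
move=> d0; apply/matrixP => i j; rewrite [RHS]mxE; have [<-|ij] := eqVneq i j.
  by rewrite !comp_mx_full_diag act_diag mulrAC divff ?mul1r.
by rewrite !comp_mx_off // edge_val_act.
Qed.

(** D A D^-1 has the characteristic polynomial of A, and the minors delete the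
    row of an input and the column of an output, where D is 1. *)
Lemma coef_row_act d x : (forall i, d i != 0) -> (forall i, i \in L -> d i = 1) ->
  evmx (act d x) (coef_row R Mt) = evmx x (coef_row R Mt).
Proof.
move=> d0 dL; apply/coef_row_eq => k kM.
pose a i : {poly R} := (d i)%:P; pose b i : {poly R} := (d i)^-1%:P.
have ab i : a i * b i = 1 by rewrite -polyCM divff.
have charE : char_poly_mx (comp_mx (act d x)) =
    scale_mx a b (char_poly_mx (comp_mx x)).
  rewrite comp_mx_act //; apply/matrixP => i j; rewrite !mxE !polyCM -/(a i) -/(b j).
  rewrite mulrBr mulrBl; congr (_ - _); have [->|_] := eqVneq i j.
    by rewrite mulr1n mulrAC ab mul1r.
  by rewrite mulr0n mulr0 mul0r.
case: k kM => [[j c]|[[i j] c]] /=.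
  by move=> _; rewrite /char_poly charE det_scale_mx mulrAC -big_split /= big1 ?mul1r.
case/andP=> iI jO; rewrite charE cofactor_scale_mx //.
  by rewrite /a dL // inE iI.
by rewrite /b dL ?invr1 // inE jO orbT.
Qed.

(** Along a walk from x to y the factors d telescope to d y / d x, which is 1 if
    x = y or if x and y are in L. *)
Lemma monomial_val_act d x m : (forall i, d i != 0) ->
  (forall i, i \in L -> d i = 1) -> path_cycle_monomial m ->
  monomial_val m (act d x) = monomial_val m x.
Proof.
move=> d0 dL; move: m; apply: path_cycle_monomial_walk => [i|z s zs ends].
  rewrite /monomial_val !big_seq1; case: i => i iP.
  by rewrite (bool_irrelevance iP (in_full_leaks i)); exact: act_diag.
rewrite !monomial_val_edges ?path_edges_all //.
have -> : \prod_(uv <- path_edges z s) edge_val (act d x) uv.2 uv.1 =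
    d (last z s) / d z * \prod_(uv <- path_edges z s) edge_val x uv.2 uv.1.
  rewrite /path_edges; elim: s z {zs ends} => [|y s IH] z /=.
    by rewrite !big_nil divff ?mul1r.
  rewrite !big_cons IH /= edge_val_act.
  by field; rewrite !d0.
case: ends => [->|[zI sO]]; first by rewrite divff ?mul1r.
by rewrite !dL ?inE ?zI ?sO ?orbT // divff ?mul1r ?oner_eq0.
Qed.

End FullLeak.

(** * Bringing a full-leak matrix into M *)

Section TorusNormalForm.
Variables (R : realType) (n : nat) (M : lcmodel n).
Local Notation Mt := (full_leak M).
Local Notation P := #|{: param M}|.
Local Notation Pt := #|{: param Mt}|.
Local Notation L := (inputs M :|: outputs M).
Hypothesis leaksE : leaks M = L.

(** A row vector d solves d *m border_mx A = ones_row if and only if d is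
    1 on L and the columns of A outside L, weighted by d, have sum zero. *)
Definition border_mx (T : pzRingType) (A : 'M[T]_n) : 'M[T]_n :=
  \matrix_(i, j) if j \in L then (i == j)%:R else A i j.

Definition ones_row (T : pzRingType) : 'rV[T]_n := \row_i (i \in L)%:R.

Lemma mul_border_mx (A : 'M[R]_n) (v : 'rV_n) j : (v *m border_mx A) 0 j =
  if j \in L then v 0 j else \sum_k v 0 k * A k j.
Proof.
rewrite mxE; case: ifP => jL; last by apply: eq_bigr => k _; rewrite mxE jL.
rewrite (bigD1 j) //= mxE jL eqxx mulr1 big1 ?addr0 // => k /negbTE kj.
by rewrite mxE jL kj mulr0.
Qed.

Lemma border_mx_inj (A : 'M[R]_n) (phi : 'I_n -> R) : \det (border_mx A) != 0 ->
  (forall i, i \in L -> phi i = 0) ->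
  (forall i, i \notin L -> \sum_k phi k * A k i = 0) -> forall i, phi i = 0.
Proof.
rewrite -unitfE -unitmxE => Bu phiL phiA.
pose v := \row_i phi i : 'rV[R]_n.
have vB : v *m border_mx A = 0.
  apply/rowP => j; rewrite mul_border_mx [RHS]mxE.
  case: ifP => [/phiL|/negbT/phiA] e0.
    by rewrite mxE e0.
  by rewrite -[RHS]e0; apply: eq_bigr => k _; rewrite mxE.
have v0 : v = 0 by rewrite -(mulmxK Bu v) vB mul0mx.
by move=> i; move/rowP/(_ i): v0; rewrite !mxE.
Qed.

(** The solution d of d *m border_mx A = ones_row, multiplied by the determinant:
    this is polynomial in A. *)
Definition torus_weight (T : comNzRingType) (A : 'M[T]_n) : 'rV[T]_n :=
  ones_row T *m \adj (border_mx A).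

(** Where it does not vanish, d exists, is unique, and has no zero entry. *)
Definition torus_mpoly : mpoly Pt R :=
  \det (border_mx (comp_mx_mpoly R Mt)) * \prod_i torus_weight (comp_mx_mpoly R Mt) 0 i.

Lemma peval_torus_poly (x : 'rV[R]_Pt) : peval x torus_mpoly =
  \det (border_mx (comp_mx x)) * \prod_i torus_weight (comp_mx x) 0 i.
Proof.
have borderE : map_mx (peval x) (border_mx (comp_mx_mpoly R Mt)) = border_mx (comp_mx x).
  apply/matrixP => i j; rewrite [LHS]mxE [RHS]mxE [X in peval x X]mxE.
  rewrite -evmx_comp_mx; case: ifP => _; first by rewrite rmorph_nat.
  by rewrite [RHS]mxE.
rewrite rmorphM rmorph_prod /= -det_map_mx borderE; congr (_ * _).
apply: eq_bigr => i _; rewrite /torus_weight -borderE -map_mx_adj.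
have -> : ones_row R = map_mx (peval x) (ones_row _).
  by apply/rowP => j; rewrite !mxE rmorph_nat.
by rewrite -map_mxM [RHS]mxE.
Qed.

Definition unembed (y : 'rV[R]_Pt) : 'rV[R]_P :=
  \row_t match enum_val t with
    | inl u => pval y (inl u : param Mt)
    | inr i => if leaks M == [set: 'I_n]%SET then comp_mx y (val i) (val i)
        else - comp_mx y (val i) (val i) -
          \sum_(k | graph M (val i) k) edge_val y k (val i)
    end.

(** In M the leak at a compartment absorbs the sum of its column; outside L there
    is none, so that the sum has to be zero. *)
Lemma unembedK (y : 'rV[R]_Pt) :
  (forall i, i \notin L -> \sum_k comp_mx y k i = 0) -> embed (unembed y) = y.
Proof.
move=> coly.
have edgeE u : pval (unembed y) (inl u) = pval y (inl u : param Mt).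
  by rewrite /pval mxE enum_rankK.
have edgeE2 i j : edge_val (unembed y) i j = edge_val y i j.
  rewrite -[RHS]mul1r (@edge_val_full _ _ M (unembed y) y (fun _ _ => 1)) ?mul1r //.
  by move=> u; rewrite mul1r edgeE.
apply: full_leak_ext => [u|i]; first by rewrite embed_edge edgeE.
rewrite embed_diag -comp_mx_full_diag [LHS]mxE eqxx.
under eq_bigr do rewrite edgeE2.
case: ifP => [leaksT|leaksN]; rewrite /leak_val.
  have iM : i \in leaks M by rewrite (eqP leaksT) finset.in_setT.
  by rewrite insubT /pval mxE enum_rankK leaksT.
have [iM|iM] := boolP (i \in leaks M).
  by rewrite insubT /pval mxE enum_rankK leaksN /= opprB opprK addrC addrA addNr add0r.
rewrite insubF ?(negbTE iM) // oppr0 add0r; apply/eqP.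
rewrite eq_sym -addr_eq0; apply/eqP; rewrite leaksE in iM.
by rewrite -[RHS](coly i iM) col_sum.
Qed.

Lemma torus_normal_form (x : 'rV[R]_Pt) : peval x torus_mpoly != 0 ->
  exists d p, [/\ forall i, d i != 0, forall i, i \in L -> d i = 1
    & act d x = embed p].
Proof.
rewrite peval_torus_poly mulf_eq0 negb_or prodf_seq_neq0 => /andP[D0 /allP W0].
set B := border_mx (comp_mx x) in D0.
have Bu : B \in unitmx by rewrite unitmxE unitfE.
pose d i := ((\det B)^-1 *: torus_weight (comp_mx x)) 0 i.
have d0 i : d i != 0.
  by rewrite /d mxE mulf_neq0 ?invr_eq0 //; exact: W0 (mem_index_enum i).
have dB : (\row_i d i) *m B = ones_row R.
  have -> : \row_i d i = (\det B)^-1 *: torus_weight (comp_mx x).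
    by apply/rowP => i; rewrite mxE.
  rewrite /torus_weight -/B -scalemxAl -mulmxA mul_adj_mx mul_mx_scalar scalerA.
  by rewrite mulVf // scale1r.
have dBE j := congr1 (fun v : 'rV[R]_n => v 0 j) dB.
have dL i : i \in L -> d i = 1.
  by move=> iL; have := dBE i; rewrite /= mul_border_mx !mxE iL.
have dA i : i \notin L -> \sum_k d k * comp_mx x k i = 0.
  move=> /negbTE iL; have := dBE i; rewrite /= mul_border_mx !mxE iL => e0.
  by rewrite -[RHS]e0; apply: eq_bigr => k _; rewrite [X in _ = X * _]mxE.
exists d, (unembed (act d x)); split=> //; rewrite unembedK // => i iL.
rewrite comp_mx_act //; under eq_bigr do rewrite mxE.
by rewrite -mulr_suml dA // mul0r.
Qed.

(** Nonzero at the point of M where all edge parameters are 1 and all leak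
    parameters are 0.  There a solution phi of the homogeneous system is harmonic
    outside L and zero on L; every compartment reaches an output, so phi = 0 by
    the maximum principle.  The columns outside L sum to 0, hence d is
    constantly 1. *)
Lemma torus_poly_neq0 : single_io_connected M -> torus_mpoly != 0.
Proof.
move=> conn; pose p : 'rV[R]_P := \row_t (if enum_val t is inl _ then 1 else 0).
have pE i j : graph M j i -> edge_val p i j = 1.
  by move=> ji; rewrite /edge_val insubT /pval mxE enum_rankK.
have pL i : leak_val p i = 0.
  by rewrite /leak_val; case: insub => // l; rewrite /pval mxE enum_rankK.
have diag i : i \notin L -> comp_mx p i i = - \sum_(k | graph M i k) 1.
  move=> iL; rewrite mxE eqxx pL; case: eqP => [lT|_].
    by move: iL; rewrite -leaksE lT finset.in_setT.
  by rewrite oppr0 add0r; congr (- _); apply: eq_bigr => k ik; rewrite pE.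
have colE (phi : 'I_n -> R) i : i \notin L ->
    \sum_k phi k * comp_mx p k i = \sum_(k | graph M i k) (phi k - phi i).
  move=> iL; rewrite weighted_col_sum diag // sumrB addrC mulrN mulr_sumr.
  congr (_ - _); apply: eq_bigr => k ik; by rewrite ?pE ?mulr1.
have max0 (phi : 'I_n -> R) : (forall i, i \in L -> phi i = 0) ->
    (forall i, i \notin L -> \sum_k phi k * comp_mx p k i = 0) ->
    forall i, phi i <= 0.
  move=> phiL phiA i.
  case: (@Order.TotalTheory.arg_maxP _ _ _ i xpredT phi isT) => m _ mmax.
  apply: le_trans (mmax i isT) _.
  have [_ [u uO /connectP[s ms uE]]] := io_reachable conn m.
  have uL : last m s \in L by rewrite -uE inE uO orbT.
  suff main x s' : path (graph M) x s' -> last x s' \in L -> phi x = phi m -> phi m = 0.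
    by rewrite (main m s).
  elim: s' x {s ms uE uL} => [|y s' IH] x /=; first by move=> _ /phiL -> <-.
  case/andP=> xy ys yL phix; have [/phiL <- //|xL] := boolP (x \in L).
  have /eqP := phiA x xL; rewrite colE //.
  rewrite -oppr_eq0 -sumrN psumr_eq0; last first.
    by move=> k _; rewrite opprB subr_ge0 phix; exact: mmax.
  move=> /allP/(_ y (mem_index_enum _)); rewrite xy opprB subr_eq0 phix => /eqP e.
  exact: IH y ys yL (esym e).
have inj (phi : 'I_n -> R) : (forall i, i \in L -> phi i = 0) ->
    (forall i, i \notin L -> \sum_k phi k * comp_mx p k i = 0) ->
    forall i, phi i = 0.
  move=> phiL phiA i; apply/eqP; rewrite eq_le max0 // -oppr_le0.
  apply: (max0 (fun k => - phi k)) => [k kL|k kL]; first by rewrite phiL ?oppr0.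
  by under eq_bigr do rewrite mulNr; rewrite sumrN phiA ?oppr0.
pose B := border_mx (comp_mx p).
have D0 : \det B != 0.
  rewrite -unitfE -unitmxE -row_free_unit; apply: row_free_inj => v vB.
  apply/rowP => j; rewrite [RHS]mxE; apply: (inj (fun k => v 0 k)) => k kL.
    by move/rowP/(_ k): vB; rewrite mul_border_mx kL [RHS]mxE.
  by move/rowP/(_ k): vB; rewrite mul_border_mx (negbTE kL) [RHS]mxE.
have oneB : const_mx 1 *m B = ones_row R.
  apply/rowP => j; rewrite mul_border_mx !mxE; case: ifP => // /negbT jL.
  rewrite (eq_bigr (fun k => 1 * comp_mx p k j)) => [|k _]; last by rewrite !mxE.
  by rewrite colE // big1 // => k _; rewrite subrr.
apply/eqP => /(congr1 (peval (embed p))); rewrite peval_torus_poly comp_mx_embed.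
rewrite -/B rmorph0 => /eqP; rewrite mulf_eq0 (negbTE D0) /= prodf_seq_eq0.
case/hasP=> i _ /=; rewrite /torus_weight -oneB -/B -mulmxA mul_mx_adj mul_mx_scalar.
by rewrite !mxE mulr1 (negbTE D0).
Qed.

End TorusNormalForm.

(** * Tangent vectors that fix the monomial cycles and paths *)

Section LogarithmicDerivative.
Variable R : realType.

(** First-order expansion of a product, through its logarithmic derivative. *)
Lemma prod_taylor (T : eqType) (s : seq T) (a x : T -> R) :
  (forall i, i \in s -> a i != 0) ->
  exists2 C, 0 <= C & forall t, `|t| <= 1 ->
    `|\prod_(i <- s) (a i + t * x i) -
      (\prod_(i <- s) a i) * (1 + t * \sum_(i <- s) x i / a i)| <= C * t ^+ 2.
Proof.
elim: s => [_|i s IH as0].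
  by exists 0 => // t _; rewrite !big_nil mulr0 addr0 mulr1 subrr normr0 mul0r.
have [|C C0 HC] := IH; first by move=> j js; apply: as0; rewrite inE js orbT.
have ai0 : a i != 0 by apply: as0; rewrite inE eqxx.
exists (`|(\prod_(i <- s) a i) * x i * \sum_(i <- s) x i / a i| + (`|a i| + `|x i|) * C).
  by rewrite addr_ge0 // mulr_ge0 // addr_ge0.
move=> t t1; rewrite !big_cons; have := HC t t1.
move: (\prod_(j <- s) (a j + _)) (\prod_(j <- s) a j) (\sum_(j <- s) _) => Q A S QAS.
have -> : (a i + t * x i) * Q - a i * A * (1 + t * (x i / a i + S)) =
    t ^+ 2 * (A * x i * S) + (a i + t * x i) * (Q - A * (1 + t * S)) by field.
apply: le_trans (ler_normD _ _) _; rewrite [leRHS]mulrDl; apply: lerD.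
  by rewrite normrM [leLHS]mulrC [`|t ^+ 2|]ger0_norm ?sqr_ge0.
rewrite normrM -mulrA; apply: ler_pM => //.
apply: le_trans (ler_normD _ _) _; rewrite lerD2l normrM.
by rewrite ler_piMl.
Qed.

Lemma flat_prod (T : eqType) (s : seq T) (a x : T -> R) (u : R -> 'rV[R]_1) :
  (forall i, i \in s -> a i != 0) ->
  (forall t, u t 0 0 = \prod_(i <- s) (a i + t * x i)) ->
  flat u -> \sum_(i <- s) x i / a i = 0.
Proof.
move=> as0 uE [D uD]; have [C C0 HC] := prod_taylor x as0.
set S := \sum_(i <- s) _ in HC *; set A := \prod_(i <- s) _ in HC *.
have A0 : A != 0.
  by rewrite prodf_seq_neq0; apply/allP => i is_; exact: as0.
suff /matrixP/(_ 0 0) : const_mx (A * S) = 0 :> 'rV[R]_1.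
  by rewrite !mxE => /eqP; rewrite mulf_eq0 (negbTE A0) => /eqP.
apply: flat_linear; exists (C + D) => t t1; rewrite scale0r subr0.
have u0 : u 0 0 0 = A by rewrite uE; apply: eq_bigr => i _; rewrite mul0r addr0.
have CD : 0 <= (C + D) * t ^+ 2.
  rewrite mulrDl; apply: addr_ge0; first by rewrite mulr_ge0 ?sqr_ge0.
  exact: le_trans (normr_ge0 _) (uD t t1).
apply: norm_mx_le => // i j; rewrite !mxE mulrDl.
have h := HC t t1; have h' := le_trans (norm_entry (u t - u 0) 0 0) (uD t t1).
rewrite !mxE uE u0 in h'.
have -> : t * (A * S) = (\prod_(i <- s) (a i + t * x i) - A) -
    (\prod_(i <- s) (a i + t * x i) - A * (1 + t * S)) by ring.
by apply: le_trans (ler_normB _ _) _; rewrite [leRHS]addrC lerD.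
Qed.

End LogarithmicDerivative.

Section TangentSpace.
Variables (R : realType) (n : nat) (M : lcmodel n).
Local Notation Mt := (full_leak M).
Local Notation P := #|{: param M}|.
Local Notation L := (inputs M :|: outputs M).
Hypothesis leaksE : leaks M = L.
Hypothesis conn : single_io_connected M.

Lemma comp_mx_eq0 (v : 'rV[R]_P) : comp_mx v = 0 -> v = 0.
Proof.
move=> v0.
have edge0 i j : graph M j i -> edge_val v i j = 0.
  by move=> ji; rewrite -comp_mx_edge // v0 mxE.
have edgeE u : pval v (inl u : param M) = 0.
  by rewrite -edge_val_edge; apply: edge0; exact: (valP u).
apply/rowP => t; rewrite -(enum_valK t) [RHS]mxE.
case: (enum_val t) => [u|l]; first exact: edgeE.
have leakE : leak_val v (val l) = pval v (inr l : param M).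
  by rewrite /leak_val valK.
have := congr1 (fun A : 'M[R]_n => A (val l) (val l)) v0; rewrite /= !mxE eqxx leakE.
case: ifP => // _; rewrite big1 ?subr0; last by move=> k ik; apply: edge0.
by move/eqP; rewrite oppr_eq0 => /eqP.
Qed.

(** With w = X_yx / A_yx on the edge x -> y, where X is the matrix of v,
    [exists_potential] gives X_yx = (phi y - phi x) A_yx.  For i outside L the
    columns i of A and X have sum zero, and X_ii = 0 by the self-cycle at i, so
    sum_k phi_k A_ki = 0: thus phi = 0 by [border_mx_inj]. *)
Lemma tangent_trivial (p v : 'rV[R]_P) :
  (forall i j, graph M j i -> edge_val p i j != 0) ->
  \det (border_mx M (comp_mx p)) != 0 ->
  (forall m, path_cycle_monomial m -> flat (fun t =>
    evmx (embed p + t *: embed v) (\row_(_ < 1) mon_mpoly R (M := Mt) m))) ->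
  v = 0.
Proof.
move=> edge0 detB flatm; apply: comp_mx_eq0.
have monE m t : evmx (embed p + t *: embed v) (\row_(_ < 1) mon_mpoly R (M := Mt) m) 0 0 =
    monomial_val m (embed p + t *: embed v) by rewrite !mxE peval_mon.
have diag0 i : comp_mx v i i = 0.
  have [C HC] : flat (fun t => t *: (const_mx (comp_mx v i i) : 'rV[R]_1)).
    have [|C HC] := flatm [:: full_leak_param M i].
      by apply: Or32; exists (exist _ i (in_full_leaks M i)).
    exists C => t t1; apply: le_trans (HC t t1).
    rewrite scale0r subr0; apply: norm_mx_le => // k l.
    apply: le_trans (norm_entry _ 0 0).
    rewrite !mxE !peval_mon /monomial_val !big_seq1 -!comp_mx_full_diag.
    rewrite !comp_mx_linear !comp_mx_embed !mxE.
    by rewrite mul0r addr0 [X in _ <= `|X|]addrC addKr.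
  have /matrixP/(_ 0 0) := flat_linear (ex_intro _ C HC).
  by rewrite !mxE.
pose w x y := comp_mx v y x / comp_mx p y x.
have walk0 x s : path (graph M) x s ->
    last x s = x \/ (x \in inputs M /\ last x s \in outputs M) ->
    path_cycle_monomial (edge_monomial Mt (path_edges x s)) ->
    \sum_(xy <- path_edges x s) w xy.1 xy.2 = 0.
  move=> xs _ /flatm fl; have al := path_edges_all xs.
  apply: (@flat_prod _ _ _ (fun xy => comp_mx p xy.2 xy.1)
      (fun xy => comp_mx v xy.2 xy.1)) fl => [[y z] yz|t].
    by have /= yz' := allP al _ yz; rewrite /= comp_mx_edge // edge0.
  rewrite monE monomial_val_edges //; rewrite [LHS]big_seq [RHS]big_seq.
  apply: eq_bigr => -[y z] yz; have /= yz' := allP al _ yz.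
  rewrite -(@comp_mx_edge _ _ Mt) // comp_mx_linear !comp_mx_embed.
  by rewrite [LHS]mxE [X in _ + X]mxE.
have [||phi [phiE phiL]] := @exists_potential n M R w conn.
- case=> [[]//|x s] cs; rewrite cycle_edges_path; apply: walk0.
  + by case: cs => _ /andP[].
  + by left; rewrite last_rcons.
  + by rewrite -cycle_edges_path; apply: Or31; exists (x :: s).
- move=> z s zs; have [zI sO pzs _] := zs; apply: walk0 => //; first by right.
  by apply: Or33; exists z, s.
have XE i j : graph M j i -> comp_mx v i j = (phi i - phi j) * comp_mx p i j.
  move=> ji; rewrite -phiE // /w divfK //.
  by rewrite comp_mx_edge // edge0.
have phi0 : forall i, phi i = 0.
  apply: (border_mx_inj detB) => // i iL.
  have leaksN : (leaks M == [set: 'I_n]%SET) = false.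
    by apply/negbTE; apply: contraNneq iL => lT; rewrite -leaksE lT finset.in_setT.
  have leak0 (q : 'rV[R]_P) : leak_val q i = 0.
    by rewrite /leak_val insubF // leaksE (negbTE iL).
  have colsum0 (q : 'rV[R]_P) : comp_mx q i i = - \sum_(k | graph M i k) edge_val q k i.
    by rewrite mxE eqxx leaksN leak0 oppr0 add0r.
  rewrite weighted_col_sum colsum0 mulrN mulr_sumr addrC -sumrB.
  rewrite (eq_bigr (fun k => edge_val v k i)).
    by apply/eqP; rewrite -oppr_eq0 -colsum0 diag0.
  by move=> k ik; rewrite -mulrBl -!comp_mx_edge // XE.
apply/matrixP => i j; rewrite [RHS]mxE; have [<-|ij] := eqVneq i j; first exact: diag0.
have [ji|ji] := boolP (graph M j i); first by rewrite XE // !phi0 subrr mul0r.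
by rewrite comp_mx_off // edge_val_notin.
Qed.

End TangentSpace.

(** * Identifiability *)

Section Identifiability.
Variables (R : realType) (n : nat) (M : lcmodel n).
Local Notation Mt := (full_leak M).
Local Notation P := #|{: param M}|.
Local Notation Pt := #|{: param Mt}|.
Local Notation L := (inputs M :|: outputs M).
Hypothesis leaksE : leaks M = L.
Hypothesis conn : single_io_connected M.

(** The rank is full where a determinant, which is a polynomial, does not
    vanish. *)
Lemma locally_identifiable_of_full_rank (p : 'rV[R]_P) : (0 < P)%N ->
  row_free (evmx p (jac (coef_row R M))) -> locally_identifiable R M.
Proof.
move=> P_gt0 /row_freeP[A JA].
pose h := \det (jac (coef_row R M) *m constmx P A).
have hE x : peval x h = \det (evmx x (jac (coef_row R M)) *m A).
  by rewrite -[in RHS](evmx_const x A) -evmxM -det_map_mx.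
exists [set x | peval x h = 0].
  apply: lebesgue_null_zeros => //; apply/eqP => /(congr1 (peval p)).
  by rewrite hE JA det1 rmorph0 => /eqP; rewrite oner_eq0.
move=> x /= /eqP hx.
have [|U xU injU] := @full_rank_locally_injective R P _ (coef_row R M) A x.
  by rewrite unitmxE unitfE -hE.
exists U; first exact: xU.
by move=> y z yU zU /io_coef_map_eq yz; exact: (injU y z yU zU yz).
Qed.

(** Local injectivity leaves one value of each coordinate on a fibre near a point;
    so at a point of maximal rank the gradients of all the coordinates vanish on
    the kernel of the Jacobian. *)
Lemma full_rank_of_locally_identifiable : (0 < P)%N -> locally_identifiable R M ->
  exists p, row_free (evmx p (jac (coef_row R M))).
Proof.
move=> P_gt0 [Z nullZ locinj].
have [h h0 hmax] := generic_max_rank (jac (coef_row R M)).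
have [p _ hp] := peval_neq0_ball P_gt0 0 h0 ltr01.
exists p; apply: row_free_inj => v vJ; apply/rowP => i; rewrite [RHS]mxE.
have fin x : ~ Z x -> exists2 U, nbhs x U & finite_set
    [set peval q (mpolyX R (mnm1 i)) | q in
      [set q | [/\ U q, ~ Z q & evmx q (coef_row R M) = evmx x (coef_row R M)]]].
  move=> /locinj[U xU injU]; exists U => //.
  apply: sub_finite_set (finite_set1 (peval x (mpolyX R (mnm1 i)))).
  move=> _ [q [Uq _ qx] <-] /=; congr (peval _ _).
  apply: (injU q x); [by rewrite inE | | exact/io_coef_map_eq].
  by rewrite inE; exact: nbhs_singleton.
have := finite_fibre_gradient P_gt0 nullZ fin (hmax p hp) vJ.
have -> : evmx p (grad (mpolyX R (mnm1 i))) = col i (evmx p (jac (varmx R P))).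
  by apply/matrixP => k l; rewrite !mxE.
rewrite jac_var => /matrixP/(_ 0 0); rewrite [RHS]mxE => <-.
rewrite mxE (bigD1 i) //= !mxE eqxx mulr1 big1 ?addr0 // => k /negbTE ki.
by rewrite !mxE ki mulr0.
Qed.

(** For Phi, take all the values of f on the fibre, outside Z. *)
Lemma locally_identifiable_funP (Z : set 'rV[R]_Pt) f : lebesgue_null Z ->
  (forall x, ~ Z x -> finite_set [set f y | y in
    [set y | ~ Z y /\ evmx y (coef_row R Mt) = evmx x (coef_row R Mt)]]) ->
  locally_identifiable_fun (M := Mt) f.
Proof.
move=> nullZ fin.
exists (fun c => [set f y | y in [set y | ~ Z y /\ io_coef_map y = c]]); split.
  move=> c; have [[x [Zx xc]]|no] := pselect (exists x, ~ Z x /\ io_coef_map x = c).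
    apply: sub_finite_set (fin x Zx) => _ [y [Zy yc] <-]; exists y => //; split=> //.
    by apply/io_coef_map_eq; rewrite yc xc.
  by apply: sub_finite_set (finite_set0 R) => z [y yP yz]; apply: no; exists y.
by exists Z => // x Zx; exists x.
Qed.

(** The relation H between the monomial and the coefficients holds on M.  On the
    full-leak model it holds wherever the torus leads to M, and therefore
    identically, as torus_mpoly is nonzero.  Outside the zeros of one nonzero
    coefficient of the relation, the values are roots of a nonzero polynomial
    that depends only on the fibre. *)
Lemma monomial_identifiable (p0 : 'rV[R]_P) (m : seq (param Mt)) :
  (0 < P)%N -> (0 < Pt)%N ->
  row_free (evmx p0 (jac (coef_row R M))) -> path_cycle_monomial m ->
  locally_identifiable_fun (R := R) (monomial_val m).
Proof.
move=> P_gt0 Pt_gt0 /row_freeP[A JA] mP; pose F := coef_row R M *m constmx P A.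
have F1 : evmx p0 (jac F) = 1%:M by rewrite jacM evmxM evmx_const.
pose mp := mon_mpoly R (M := Mt) m.
have monE x : peval x mp = monomial_val m x by exact: peval_mon.
have [f fE] := peval_comp (embed_mpoly R M) mp.
have [D [g [[k0 [x0 gx0]] grel]]] := algebraic_relation f P_gt0 F1.
pose Ft := coef_row R Mt *m constmx Pt A.
have FtE x : evmx x Ft = evmx x (coef_row R Mt) *m A by rewrite evmxM evmx_const.
have FtF x : evmx (embed x) Ft = evmx x F.
  by rewrite FtE evmxM evmx_const (coef_row_full_eq (comp_mx_embed x)).
have [gt gtE] : exists gt : 'I_D -> mpoly Pt R,
    forall k x, peval x (gt k) = peval (evmx x Ft) (g k).
  have /choice[gt gtP] := fun k => peval_comp Ft (g k).
  by exists gt.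
pose H := \sum_k gt k * mp ^+ k.
have HE x : peval x H = \sum_k peval (evmx x Ft) (g k) * monomial_val m x ^+ k.
  rewrite rmorph_sum; apply: eq_bigr => k _ /=.
  by rewrite rmorphM rmorphXn /= gtE monE.
have H0 : H = 0.
  have : H * torus_mpoly R M = 0.
    apply: (peval_inj Pt_gt0) => x; rewrite rmorphM /=.
    have [->|tx] := eqVneq (peval x (torus_mpoly R M)) 0; first by rewrite mulr0.
    have [d [p [d0 dL dx]]] := torus_normal_form leaksE tx.
    rewrite HE FtE -(coef_row_act _ d0 dL) -(monomial_val_act x d0 dL mP) dx -FtE FtF.
    by rewrite -monE /embed -fE grel mul0r.
  move/eqP; rewrite mulf_eq0 (negbTE (torus_poly_neq0 R leaksE conn)) orbF.
  by move/eqP.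
have gt0 : gt k0 != 0.
  apply: contraNneq gx0 => gt0; have := gtE k0 (embed x0).
  by rewrite gt0 rmorph0 FtF => <-.
apply: (locally_identifiable_funP (lebesgue_null_zeros Pt_gt0 gt0)) => x /= /eqP gx.
pose q := \poly_(k < D) (if insub k is Some k' then peval (evmx x Ft) (g k') else 0).
have qE z : q.[z] = \sum_k peval (evmx x Ft) (g k) * z ^+ k.
  by rewrite horner_poly; apply: eq_bigr => k _; rewrite valK.
have q0 : q != 0.
  apply: contraNneq gx => q0; have := congr1 (fun r : {poly R} => r`_k0) q0.
  by rewrite /= coef_poly ltn_ord valK coef0 gtE => ->.
apply: sub_finite_set (finite_roots q0) => _ [y [_ yx] <-] /=.
by rewrite qE; have := HE y; rewrite H0 rmorph0 !FtE yx => <-.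
Qed.

Lemma param_gt0 : (0 < P)%N /\ (0 < Pt)%N.
Proof.
have [i iI] : exists i, i \in inputs M by apply/finset.set0Pn/inputs_neq0.
have iL : i \in leaks M by rewrite leaksE inE iI.
by split; apply/card_gt0P; [exists (inr (exist _ i iL)) | exists (full_leak_param M i)].
Qed.

(** The generic point x is moved to the point embed p of M by the torus element d,
    and a tangent vector v of M at p is moved back to x by its inverse d'. *)
Lemma full_rank_of_path_cycle : identifiable_path_cycle_model R Mt ->
  exists p, row_free (evmx p (jac (coef_row R M))).
Proof.
case=> _ mon_id _; have [P_gt0 Pt_gt0] := param_gt0.
have [h h0 hmax] := generic_max_rank (jac (coef_row R Mt)).
(* Generic also means that no edge parameter vanishes. *)
pose E := \prod_(u : edge_type M) var_mpoly R (inl u : param Mt).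
have E0 : E != 0.
  apply/prodf_neq0 => u _; apply/eqP => /(congr1 (peval (const_mx 1))).
  by rewrite peval_var /pval mxE rmorph0 => /eqP; rewrite oner_eq0.
have T0 := torus_poly_neq0 R leaksE conn.
have [|x _] := @peval_neq0_ball R Pt Pt_gt0 (h * E * torus_mpoly R M) 0 1 _ ltr01.
  by apply: mulf_neq0 => //; apply: mulf_neq0.
rewrite rmorphM /= [peval x (h * E)]rmorphM /= 2!mulf_eq0 !negb_or.
move=> /andP[/andP[hx Ex] Tx].
have [d [p [d0 dL dx]]] := torus_normal_form leaksE Tx.
have edge_x i j : graph M j i -> edge_val x i j != 0.
  have EE : peval x E = \prod_(u : edge_type M) pval x (inl u : param Mt).
    by rewrite rmorph_prod; apply: eq_bigr => u _; exact: peval_var.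
  move=> ji; move: Ex; rewrite EE => /prodf_neq0/(_ (exist _ (j, i) ji) isT).
  by rewrite -(@edge_val_edge _ _ Mt).
have edge_p i j : edge_val p i j = d i * edge_val x i j / d j.
  rewrite -edge_val_act dx (@edge_val_full _ _ M p _ (fun _ _ => 1)) ?mul1r //.
  by move=> u; rewrite mul1r embed_edge.
have comp_p : comp_mx p = scale_mx d (fun j => (d j)^-1) (comp_mx x).
  by rewrite -comp_mx_act // dx comp_mx_embed.
have det_x : \det (border_mx M (comp_mx x)) != 0.
  by move: Tx; rewrite peval_torus_poly mulf_eq0 negb_or => /andP[].
have det_p : \det (border_mx M (comp_mx p)) != 0.
  rewrite -unitfE -unitmxE -row_free_unit; apply: row_free_inj => v vB.
  have vBE j := congr1 (fun u : 'rV[R]_n => u 0 j) vB.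
  suff vd : forall k, v 0 k * d k = 0.
    apply/rowP => k; rewrite [RHS]mxE; apply/eqP; have /eqP := vd k.
    by rewrite mulf_eq0 (negbTE (d0 k)) orbF.
  apply: (border_mx_inj det_x) => k kL; have := vBE k; rewrite /= mul_border_mx.
    by rewrite kL [RHS]mxE => ->; rewrite mul0r.
  rewrite (negbTE kL) [RHS]mxE comp_p => e0.
  have /mulIf : (d k)^-1 != 0 by rewrite invr_eq0.
  apply; rewrite mul0r -[RHS]e0 mulr_suml; apply: eq_bigr => l _.
  by rewrite [scale_mx _ _ _ l k]mxE !mulrA.
exists p; apply: row_free_inj => v vJ.
apply: (tangent_trivial leaksE conn _ det_p) => [i j ji|m mP].
  by rewrite edge_p !mulf_neq0 ?invr_eq0 // edge_x.
pose d' i := (d i)^-1.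
have d'0 i : d' i != 0 by rewrite invr_eq0.
have d'L i : i \in L -> d' i = 1 by move=> /dL; rewrite /d' => ->; rewrite invr1.
have xE : x = act d' (embed p).
  rewrite -dx; apply: full_leak_ext => [u|i]; last by rewrite !act_diag.
  rewrite -!edge_val_edge !edge_val_act /d'; field.
  by rewrite !d0.
have uJ : act d' (embed v) *m evmx x (jac (coef_row R Mt)) = 0.
  apply/jac_flat; have /jac_flat[C HC] := vJ; exists C => t t1.
  have cE s : evmx (x + s *: act d' (embed v)) (coef_row R Mt) =
      evmx (p + s *: v) (coef_row R M).
    rewrite xE -act_linear coef_row_act // -embed_linear.
    by apply: coef_row_full_eq; rewrite comp_mx_embed.
  by rewrite !cE; exact: HC.
have [Phi [Phi_fin [Z nullZ ZPhi]]] := mon_id m mP.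
have fin y : ~ Z y -> exists2 U, nbhs y U & finite_set
    [set peval q (mon_mpoly R m) | q in [set q | [/\ U q, ~ Z q &
      evmx q (coef_row R Mt) = evmx y (coef_row R Mt)]]].
  move=> Zy; exists setT; first exact: filterT.
  apply: sub_finite_set (Phi_fin (io_coef_map y)) => _ [q [_ Zq qy] <-].
  rewrite peval_mon; have <- : io_coef_map q = io_coef_map y by apply/io_coef_map_eq.
  exact: ZPhi.
have /jac_flat[C HC] := finite_fibre_gradient Pt_gt0 nullZ fin (hmax x hx) uJ.
exists C => t t1.
have mE s : evmx (x + s *: act d' (embed v)) (\row_(_ < 1) mon_mpoly R m) =
    evmx (embed p + s *: embed v) (\row_(_ < 1) mon_mpoly R m).
  apply/matrixP => i j; rewrite !mxE !peval_mon xE -act_linear.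
  exact: monomial_val_act.
by rewrite -!mE; exact: HC.
Qed.

End Identifiability.

Theorem corollary4p3 (R : realType) (n : nat) (M : lcmodel n)
  (leaksE : leaks M = (inputs M :|: outputs M)%SET)
  (connM : (strongly_io_connected M /\ #|outputs M| = 1%N) \/
           (strongly_connected M /\ #|inputs M| = 1%N)) :
  locally_identifiable R M <-> identifiable_path_cycle_model R (full_leak M).
Proof.
have [P_gt0 Pt_gt0] := param_gt0 leaksE; split=> [locid|pcid]; last first.
  have [p full] := full_rank_of_path_cycle leaksE connM pcid.
  exact: locally_identifiable_of_full_rank P_gt0 full.
have [p full] := full_rank_of_locally_identifiable P_gt0 locid.
split=> // [m|[u|l]].
- exact: (@monomial_identifiable R n M leaksE connM p m P_gt0 Pt_gt0 full).
- have uM : graph M (val u).1 (val u).2 := valP u.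
  have in_monomial es : ((val u).1, (val u).2) \in es ->
      inl u \in edge_monomial (full_leak M) es.
    move=> ues; apply/mapP; exists u => //.
    rewrite mem_pmap; apply/mapP; exists (val u); rewrite ?valK //.
    by rewrite [val u]surjective_pairing.
  have [[s cs us]|[z [s [zs us]]]] := edge_in_cycle_or_path connM uM.
    exists (edge_monomial _ (cycle_edges s)); last exact: in_monomial.
    by apply: Or31; exists s.
  exists (edge_monomial _ (path_edges z s)); last exact: in_monomial.
  by apply: Or33; exists z, s.
by exists [:: inr l]; [apply: Or32; exists l | rewrite inE].
Qed.
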